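(* For each $\alpha\in(0,2]$, let $p=\frac{2}{\alpha}-1\ge 0$ (so that $\alpha=\frac{2}{1+p}$). The class of all stationary solutions of the equation $$\frac{\partial}{\partial t}\varphi(\xi,t)=\frac{1}{2\pi}\int_{0}^{2\pi}\varphi(\xi c_p(\theta),t)\,\varphi(\xi s_p(\theta),t)\,d\theta-\varphi(\xi,t)\quad(\xi\in\mathbb{R},\ t>0),$$ with initial condition $\varphi(\cdot,0)=\varphi_0$, $\varphi_0$ being the characteristic function of a probability distribution on $\mathbb{R}$, coincides with the class of all symmetric stable laws $g_\alpha$ with characteristic function $$\hat g_\alpha(\xi)=e^{-a_0|\xi|^\alpha}\quad(\xi\in\mathbb{R})$$ as $a_0$ varies in $[0,+\infty)$.
   Context: For $p\ge 0$ and $\theta\in(0,2\pi]$ put $c_p(\theta):=\cos\theta\,|\cos\theta|^p$ and $s_p(\theta):=\sin\theta\,|\sin\theta|^p$. The characteristic function of a probability distribution $m$ on the Borel sets of $\mathbb{R}$ is $\hat m(\xi)=\int_{\mathbb{R}}e^{i\xi x}\,m(dx)$; probability distributions are identified with their characteristic functions. Solutions are understood in the class of characteristic functions: $\varphi(\cdot,t)$ is a characteristic function for every $t\ge0$; for every initial characteristic function $\varphi_0$ there is one and only one such solution. A stationary solution is a solution $\varphi(\cdot,t)$, consisting of characteristic functions, such that $\frac{\partial}{\partial t}\varphi(\cdot,t)\equiv 0$. *)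

(* Defs.v *)
From mathcomp Require Import all_boot all_order all_algebra.
From mathcomp Require Import all_classical all_reals all_analysis.
From mathcomp Require Import complex.

Set Implicit Arguments.
Unset Strict Implicit.
Unset Printing Implicit Defensive.

Import Order.TTheory GRing.Theory Num.Theory.
Import numFieldNormedType.Exports.

Local Open Scope classical_set_scope.
Local Open Scope ring_scope.
Local Open Scope complex_scope.

(* The library has no R-normed topology on R[i]: integrals, derivatives and
   limits of complex-valued functions of real variables are componentwise. *)

Definition Cintegral (R : realType) (d : measure_display) (T : measurableType d)
    (mu : {measure set T -> \bar R}) (D : set T) (f : T -> R[i]) : R[i] :=
  (\int[mu]_(x in D) complex.Re (f x)) +i* (\int[mu]_(x in D) complex.Im (f x)).

Definition Cis_derive1 (R : realType) (f : R -> R[i]) (t : R) (l : R[i]) : Prop :=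
  is_derive t 1 (fun s => complex.Re (f s)) (complex.Re l) /\
  is_derive t 1 (fun s => complex.Im (f s)) (complex.Im l).

Definition Cright_continuous (R : realType) (f : R -> R[i]) (t : R) : Prop :=
  (complex.Re (f s) @[s --> t^'+] --> complex.Re (f t)) /\
  (complex.Im (f s) @[s --> t^'+] --> complex.Im (f t)).

Definition expi (R : realType) (x : R) : R[i] := cos x +i* sin x.

Definition charfun (R : realType) (m : probability (measurableTypeR R) R)
    (xi : R) : R[i] :=
  Cintegral m setT (fun x : measurableTypeR R => expi (xi * x)).

Definition is_charfun (R : realType) (phi : R -> R[i]) : Prop :=
  exists m : probability (measurableTypeR R) R, phi =1 charfun m.

(* Since 0 `^ 0 = 1 and 0 `^ p = 0 for p > 0, both functions vanish where the
   cosine, resp. the sine, does, for every p >= 0. *)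
Definition c_ (R : realType) (p theta : R) : R := cos theta * `|cos theta| `^ p.
Definition s_ (R : realType) (p theta : R) : R := sin theta * `|sin theta| `^ p.

Definition kac_rhs (R : realType) (p : R) (psi : R -> R[i]) (xi : R) : R[i] :=
  ((2 * pi)^-1)%:C *
    Cintegral lebesgue_measure `[0, 2 * pi]
      (fun theta : measurableTypeR R =>
         psi (xi * c_ p theta) * psi (xi * s_ p theta))
  - psi xi.

(* phi xi t is only constrained for t >= 0.  Right-continuity at t = 0 ties the
   initial datum to the equation, which is imposed for t > 0 only. *)
Definition solution (R : realType) (p : R) (phi0 : R -> R[i])
    (phi : R -> R -> R[i]) : Prop :=
  [/\ forall t, 0 <= t -> is_charfun (phi^~ t),
      forall xi, phi xi 0 = phi0 xi,
      forall xi, Cright_continuous (phi xi) 0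
    & forall xi t, 0 < t -> Cis_derive1 (phi xi) t (kac_rhs p (phi^~ t) xi)].

Definition stationary_solution (R : realType) (p : R) (phi0 : R -> R[i])
    (phi : R -> R -> R[i]) : Prop :=
  solution p phi0 phi /\ forall xi t, 0 < t -> Cis_derive1 (phi xi) t 0.

Definition stable_cf (R : realType) (alpha a0 xi : R) : R[i] :=
  (expR (- (a0 * `|xi| `^ alpha)))%:C.

(* Main.v *)
Require Import Defs.
From HB Require Import structures.
From mathcomp Require Import all_boot all_order all_algebra.
From mathcomp Require Import all_classical all_reals all_analysis.
From mathcomp Require Import measurable_realfun complex ring lra.
Import Order.TTheory GRing.Theory Num.Theory.
Import numFieldNormedType.Exports.
Local Open Scope classical_set_scope.
Local Open Scope ring_scope.

Set Implicit Arguments.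
Unset Strict Implicit.
Unset Printing Implicit Defensive.

(** With [E] the mean over the angles in [0, pi/2], a stationary characteristic
    function is real and even, and [g y := phi (|y| ^ (1 + p))] satisfies
    [g y = E (g (y cos) * g (y sin))].  Then [g > 0], and if [k] is the infimum
    of [- ln g / y^2] on [(0, Y]], evaluating the equation at a minimiser shows
    that [k] is approached at 0.  The defect [D y := exp (- k y^2) - g y >= 0]
    satisfies [D y <= 2 E (D (y cos))], with [E (D (y cos)) = o(y^2)] along some
    sequence [y -> 0].  Put [K r := int_b^r x D(1/x) dx] and
    [J r := int cos^2 (K (r/cos) - K r)]: the first property makes [J]
    nondecreasing, the second makes [J r] vanish along [r -> oo].
    Hence [J = 0], so [D = 0] and [g] is Gaussian.

    Conversely [exp (- a |xi|^alpha)] is a limit of products of a Gaussian with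
    exponentials of mixtures of cosines (truncate the Levy measure), so its
    Fourier transform is nonnegative and Fourier inversion gives its density;
    it is stationary because [cos^2 + sin^2 = 1]. *)

(** * Integrals over segments and over the quarter circle *)

(** No moment of the stationary law is assumed, so [g] need not have a second order expansion at 0,
    and the rate [k] is only reached along some sequence. Iterating [D y <= 2 E (D (y cos))] does
    not conclude either: since [E (cos^2) = 1/2], every multiple of [y^2] satisfies it with
    equality, so the quadratic order is exactly critical. [J] is a monotone quantity made for this
    critical case: in its derivative the weight [cos^2] cancels both factors [1/cos], so [J' r / r]
    is the integral of [D (cos t / r) - cos^2 t D (1/r)], whose sign is that inequality. Integration
    by parts in [t] bounds [J r] by a multiple of [r^2 E (D (cos / r))]; smallness along one
    sequence then suffices, by monotonicity.

    In the converse the Levy measure has infinite mass near 0. Once it is truncated,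
    [exp (- int (1 - cos))] is a constant times the exponential of a mixture of cosines, and the
    exponential series has nonnegative coefficients. The Gaussian factor supplies integrability
    until the truncation is removed. *)

Section integral_on_segments.
Context {R : realType}.
Notation mu := (@lebesgue_measure R).
Implicit Types (f F : R -> R) (a b c x : R).

Lemma cont_integrable f a b : continuous f -> mu.-integrable `[a, b] (EFin \o f).
Proof.
move=> cf; apply: continuous_compact_integrable; first exact: segment_compact.
by apply: continuous_subspaceT => x; exact: cf.
Qed.

Lemma Rintegral_reflect c f a b : a <= b -> continuous f ->
  \int[mu]_(x in `[a, b]) f (c - x) = \int[mu]_(x in `[c - b, c - a]) f x.
Proof.
move=> ab cf; rewrite /Rintegral; congr fine.
have d (x : R) : is_derive x 1 (fun x : R => c - x) (-1).
  by apply: is_derive_eq; rewrite add0r mul1r.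
have -> := @integration_by_substitution_decreasing R (fun x => c - x) f a b ab.
- apply: eq_integral => x _ /=; congr EFin.
  rewrite /GRing.mul/= [X in _ * - X](_ : _ = -1) ?opprK ?mulr1//.
  by rewrite derive1E (@derive_val _ _ _ _ _ _ _ (d x)).
- by move=> x y _ _ xy; rewrite ltrD2l ltrN2.
- have -> : (fun x : R => c - x)^`()%classic = cst (-1).
    by apply/funext => x; rewrite derive1E (@derive_val _ _ _ _ _ _ _ (d x)).
  by move=> x _; exact: cvg_cst.
- have -> : (fun x : R => c - x)^`()%classic = cst (-1).
    by apply/funext => x; rewrite derive1E (@derive_val _ _ _ _ _ _ _ (d x)).
  exact: is_cvg_cst.
- have -> : (fun x : R => c - x)^`()%classic = cst (-1).
    by apply/funext => x; rewrite derive1E (@derive_val _ _ _ _ _ _ _ (d x)).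
  exact: is_cvg_cst.
- split.
  + by move=> x _; exact: (@ex_derive _ _ _ _ _ _ _ (d x)).
  + apply: cvg_at_right_filter; apply: cvgB; [exact: cvg_cst|exact: cvg_id].
  + apply: cvg_at_left_filter; apply: cvgB; [exact: cvg_cst|exact: cvg_id].
- by apply: continuous_subspaceT => x; exact: cf.
Qed.

Lemma Rintegral_split f a b x : a <= x -> x <= b -> continuous f ->
  \int[mu]_(t in `[a, b]) f t =
  \int[mu]_(t in `[a, x]) f t + \int[mu]_(t in `[x, b]) f t.
Proof.
move=> ax xb cf.
rewrite -(@Rintegral_itv_obnd_cbnd _ x).
  rewrite -(@Rintegral_itvB _ _ (BLeft a) (BRight b) x) ?bnd_simp//.
    by rewrite addrC subrK.
  exact: cont_integrable.
apply: integrableS (@cont_integrable f x b cf) => //.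
by move=> y /=; rewrite !in_itv/= => /andP[/ltW -> ->].
Qed.

Lemma Rintegral_even f a b : a <= b -> continuous f ->
  (forall x, f (a + b - x) = f x) ->
  \int[mu]_(x in `[a, b]) f x = 2 * \int[mu]_(x in `[a, (a + b) / 2]) f x.
Proof.
move=> ab cf sf.
have am : a <= (a + b) / 2 by lra.
have mb : (a + b) / 2 <= b by lra.
rewrite (@Rintegral_split f a b ((a + b) / 2))// mulr_natl mulr2n; congr (_ + _).
have -> : `[(a + b) / 2, b] = `[a + b - (a + b) / 2, a + b - a] :> interval R.
  by congr `[_, _]; field.
by rewrite -Rintegral_reflect//; apply: eq_Rintegral => x _; rewrite sf.
Qed.

Lemma Rintegral_odd f a b : a <= b -> continuous f ->
  (forall x, f (a + b - x) = - f x) -> \int[mu]_(x in `[a, b]) f x = 0.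
Proof.
move=> ab cf sf.
have := @Rintegral_reflect (a + b) f a b ab cf.
rewrite addrK (addrC a b) addrK.
under eq_Rintegral do rewrite addrC sf.
have -> : \int[mu]_(x in `[a, b]) - f x = - \int[mu]_(x in `[a, b]) f x.
  rewrite -mulN1r -RintegralZl//; last exact: cont_integrable.
  by apply: eq_Rintegral => x _; rewrite mulN1r.
lra.
Qed.

Lemma derivable_Rintegral f a u x : a < x -> x < u -> continuous f ->
  is_derive x 1 (fun y => \int[mu]_(t in `[a, y]) f t) (f x).
Proof.
move=> ax xu cf.
have [|dF FE] := @continuous_FTC1_closed R f a x u xu _ ax (cf x).
  exact: cont_integrable.
by apply: DeriveDef => //; rewrite -derive1E FE.
Qed.

(** The primitive of [f] from [a] lies between 0 and the whole integral, hence vanishes on the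
    segment, and so does its derivative. Every later passage from an integral equality to a
    pointwise one goes through this lemma. *)
Lemma Rintegral_segment_eq0 f a b : continuous f ->
  (forall x, a <= x <= b -> 0 <= f x) -> \int[mu]_(x in `[a, b]) f x <= 0 ->
  forall x, a < x < b -> f x = 0.
Proof.
move=> cf f0 If x /andP[ax xb].
pose F y := \int[mu]_(t in `[a, y]) f t.
have F0 y : a < y < b -> F y = 0.
  move=> /andP[ay yb]; apply/eqP; rewrite eq_le; apply/andP; split.
    apply: le_trans If; rewrite (@Rintegral_split f a b y) ?(ltW ay) ?(ltW yb)// lerDl.
    apply: Rintegral_ge0 => z /=; rewrite in_itv/= => /andP[yz zb].
    by apply: f0; rewrite zb (le_trans (ltW ay)).
  apply: Rintegral_ge0 => z /=; rewrite in_itv/= => /andP[yz zb].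
  by apply: f0; rewrite yz (le_trans zb)// ltW.
have dF : is_derive x 1 F (f x) by exact: derivable_Rintegral xb cf.
have d0 : is_derive x 1 (cst 0 : R -> R) 0 by exact: is_derive_cst.
rewrite -(@derive_val _ _ _ _ _ _ _ dF) -(@derive_val _ _ _ _ _ _ _ d0).
apply: near_eq_derive.
have : x \in `]a, b[ by rewrite in_itv/= ax.
move=> /near_in_itvoo; apply: filterS => y /=; rewrite in_itv/=.
exact: F0.
Qed.

End integral_on_segments.

Section quarter_circle.
Context {R : realType}.
Notation mu := (@lebesgue_measure R).
Implicit Types (f g h : R -> R) (a b c x y t : R).

Lemma continuous_scale f h y : continuous f -> continuous h ->
  continuous (fun t => f (y * h t)).
Proof.
move=> cf ch t; apply: (@continuous_comp _ _ _ (fun t => y * h t) f); last exact: cf.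
by apply: cvgM; [exact: cvg_cst|exact: ch].
Qed.

Lemma quarter_cos t : 0 <= t <= pi / 2 -> 0 <= cos t <= 1.
Proof.
by move=> /andP[t0 t1]; rewrite cos_le1 andbT cos_ge0_pihalf// t1 andbT; have := pi_gt0 R; lra.
Qed.

Lemma quarter_sin t : 0 <= t <= pi / 2 -> 0 <= sin t <= 1.
Proof.
move=> /andP[t0 t1]; rewrite sin_le1 andbT sin_ge0_pi// t0/=.
by have := pi_gt0 R; lra.
Qed.

Lemma quarter_cos_gt0 t : 0 <= t < pi / 2 -> 0 < cos t.
Proof.
by move=> /andP[t0 t1]; rewrite cos_gt0_pihalf// t1 andbT; have := pi_gt0 R; lra.
Qed.

Lemma quarter_lt1 t : 0 < t < pi / 2 -> [/\ 0 < cos t, cos t < 1, 0 < sin t & sin t < 1].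
Proof.
move=> /andP[t0 t1].
have c0 : 0 < cos t by rewrite quarter_cos_gt0 ?t1 ?(ltW t0).
have s0 : 0 < sin t by rewrite sin_gt0_pihalf ?t0.
by split => //; have := cos2Dsin2 t; nra.
Qed.

Lemma quarter_cos_onto c : 0 < c < 1 -> exists2 t, 0 < t < pi / 2 & cos t = c.
Proof.
move=> /andP[c0 c1]; have pi0 : 0 < pi / 2 :> R by rewrite divr_gt0// pi_gt0.
have [||t] := @IVT R cos 0 (pi / 2) c (ltW pi0).
- by apply: continuous_subspaceT => x; exact: continuous_cos.
- by rewrite cos0 cos_pihalf ge_min le_max (ltW c0) (ltW c1) orbT.
rewrite in_itv/= => /andP[t0 t1] ct; exists t => //.
rewrite !lt_neqAle t0 t1 !andbT; apply/andP; split; apply/eqP => E.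
  by move: ct; rewrite -E cos0; lra.
by move: ct; rewrite E cos_pihalf; lra.
Qed.

Lemma Rintegral_cos_sin f : continuous f ->
  \int[mu]_(t in `[0, pi / 2]) f (sin t) = \int[mu]_(t in `[0, pi / 2]) f (cos t).
Proof.
move=> cf; have := @Rintegral_reflect R (pi / 2) (f \o cos) 0 (pi / 2).
rewrite subr0 subrr /= => <-.
- by apply: eq_Rintegral => t _; rewrite -[in RHS]opprB cosN cosBpihalf.
- by rewrite divr_ge0// pi_ge0.
- by move=> t; apply: continuous_comp; [exact: continuous_cos|exact: cf].
Qed.

End quarter_circle.

(** * The fixed point equation *)

Section fixed_point.
Context {R : realType}.
Notation mu := (@lebesgue_measure R).
Variable g : R -> R.
Hypothesis cg : continuous g.
Hypothesis g0 : g 0 = 1.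
Hypothesis gle1 : forall y, g y <= 1.
Hypothesis gE : forall y : R, 0 <= y ->
  \int[mu]_(t in `[0, pi / 2]) (g (y * cos t) * g (y * sin t)) = pi / 2 * g y.

Let pi20 : 0 < pi / 2 :> R. Proof. by rewrite divr_gt0// pi_gt0. Qed.

Let cgg y : continuous (fun t => g (y * cos t) * g (y * sin t)).
Proof.
move=> t; apply: cvgM; apply: continuous_scale => //.
- exact: continuous_cos.
- exact: continuous_sin.
Qed.

(** At the first point where [g] stops being positive it vanishes by continuity, so the equation
    there has right-hand side 0; yet its integrand is a product of values of [g] at smaller points,
    which are positive. *)
Lemma fixed_point_gt0 y : 0 <= y -> 0 < g y.
Proof.
move=> y0; rewrite ltNge; apply/negP => gy.
pose S : set R := [set x | 0 <= x /\ g x <= 0].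
have Sy : S y by [].
have lbS : lbound S 0 by move=> x [].
have hS : has_inf S by split; [exists y|exists 0].
have i0 : 0 <= inf S by apply: lb_le_inf; [exists y|].
have ltS x : 0 <= x -> x < inf S -> 0 < g x.
  move=> x0 xi; rewrite ltNge; apply/negP => gx.
  have : inf S <= x by apply: ge_inf; [exists 0|].
  by rewrite leNgt xi.
have gi : g (inf S) <= 0.
  rewrite leNgt; apply/negP => gi.
  have [e /= e0 He] : \forall x \near inf S, 0 < g x by exact: (cvgr_gt _ (@cg (inf S))).
  have [x Sx xe] := inf_adherent e0 hS.
  have ix : inf S <= x by apply: ge_inf => //; exists 0.
  have : 0 < g x by apply: He; rewrite /= distrC ger0_norm ?subr_ge0// ltrBlDl.
  by case: Sx => _; rewrite leNgt => /negP.
have ine0 : 0 < inf S.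
  by rewrite lt_neqAle i0 andbT; apply/eqP => E; move: gi; rewrite -E g0; lra.
have gi0 : 0 <= g (inf S).
  rewrite leNgt; apply/negP => gilt.
  have [e /= e0 He] : \forall x \near inf S, g x < 0 by exact: (cvgr_lt _ (@cg (inf S))).
  pose x := Num.max 0 (inf S - e / 2).
  have x0 : 0 <= x by rewrite le_max lexx.
  have xi : x < inf S by rewrite gt_max ine0/= ltrBlDr ltrDl divr_gt0.
  have xe : inf S - e / 2 <= x by rewrite le_max lexx orbT.
  have := ltS x x0 xi; apply/negP; rewrite -leNgt ltW//; apply: He => /=.
  by rewrite ger0_norm ?subr_ge0 ?ltW//; lra.
have ge0 x : 0 <= x <= inf S -> 0 <= g x.
  by move=> /andP[x0]; rewrite le_eqVlt => /orP[/eqP ->//|xi]; rewrite ltW// ltS// x0.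
(* Any interior angle would do: it makes both arguments strictly smaller than [inf S]. *)
have t0 : 0 < (pi / 4 : R) < pi / 2 by have := pi_gt0 R; lra.
have [c0 c1 s0 s1] := quarter_lt1 t0.
have : g (inf S * cos (pi / 4)) * g (inf S * sin (pi / 4)) = 0.
  apply: (@Rintegral_segment_eq0 R (fun t => g (inf S * cos t) * g (inf S * sin t)) 0 (pi/2)) => //.
    move=> t /[dup] /quarter_cos/andP[ct0 ct1] /quarter_sin/andP[st0 st1].
    by rewrite mulr_ge0// ge0//; apply/andP; split; nra.
  by rewrite gE// mulr_ge0_le0// ltW.
by apply/eqP; rewrite gt_eqF// mulr_gt0// ltS//; nra.
Qed.

(* [k] is the infimum of [- ln (g y) / y ^+ 2]; it is approached at 0 because a minimiser [m] of it over a segment away from 0 would, by the equation, force the value [k] at all [m * cos t], also near 0. *)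
Lemma fixed_point_rate Y : 0 < Y -> exists k, [/\ 0 <= k,
  forall y, 0 <= y <= Y -> g y <= expR (- (k * y ^+ 2)) &
  forall d e, 0 < d -> 0 < e -> exists l,
    [/\ 0 < l, l < d, l <= Y & expR (- ((k + e) * l ^+ 2)) <= g l]].
Proof.
move=> Y0.
(* The infimum of [- ln g / y ^+ 2] is encoded as the supremum of the admissible Gaussian rates,
   which avoids the quotient at [y = 0]. *)
pose S : set R := [set K | 0 <= K /\ forall y, 0 <= y <= Y -> g y <= expR (- (K * y ^+ 2))].
have SE K y : 0 <= y -> (g y <= expR (- (K * y ^+ 2))) = (K * y ^+ 2 <= - ln (g y)).
  move=> y0; rewrite -ler_ln ?posrE ?expR_gt0 ?fixed_point_gt0//.
  by rewrite expRK lerNr.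
have S0 : S 0.
  by split => // y _; rewrite mul0r oppr0 expR0.
have ubS : ubound S (- ln (g Y) / Y ^+ 2).
  move=> K [K0 /(_ Y)]; rewrite SE ?(ltW Y0)//= lexx => /(_ isT) H.
  by rewrite ler_pdivlMr// exprn_gt0.
have hS : has_sup S by split; [exists 0|exists (- ln (g Y) / Y ^+ 2)].
have k0 : 0 <= sup S by apply: ub_le_sup => //; case: hS.
have kS : forall y, 0 <= y <= Y -> g y <= expR (- (sup S * y ^+ 2)).
  move=> y /andP[y0 yY]; rewrite SE//.
  move: y0; rewrite le_eqVlt => /orP[/eqP <-|y0].
    by rewrite g0 ln1 expr0n/= mulr0 oppr0.
  rewrite -ler_pdivlMr ?exprn_gt0//; apply: sup_le_ub; first by exists 0.
  move=> K [K0 /(_ y)]; rewrite SE ?(ltW y0)//= yY => /(_ isT) H.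
  by rewrite ler_pdivlMr// exprn_gt0.
exists (sup S); split => // d e d0 e0; apply: contrapT => N.
have {}N l : 0 < l -> l < d -> l <= Y -> g l <= expR (- ((sup S + e) * l ^+ 2)).
  move=> l0 ld lY; rewrite leNgt; apply/negP => H; apply: N.
  by exists l; split => //; exact: ltW.
(* Below [q] the negated claim [N] gives the better rate [sup S + e]; on [[q, Y]] compactness
   provides a maximiser [m] of [u], that is, of the ratio of [g] to the Gaussian bound. *)
pose q := Num.min d Y / 2.
have q0 : 0 < q by rewrite divr_gt0// lt_min d0.
have mY : Num.min d Y <= Y by rewrite ge_min lexx orbT.
have md : Num.min d Y <= d by rewrite ge_min lexx.
have qY : q < Y by rewrite /q; lra.
have qd : q < d by rewrite /q; lra.
pose u y := g y * expR (sup S * y ^+ 2).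
have cu : continuous u.
  move=> y; apply: cvgM; first exact: cg.
  apply: (@continuous_comp _ _ _ (fun y : R => sup S * y ^+ 2) expR); last exact: continuous_expR.
  by apply: cvgM; [exact: cvg_cst|exact: exprn_continuous].
have [m mI mM] := @EVT_max R u q Y (ltW qY) (continuous_subspaceT cu).
move: mI; rewrite in_itv/= => /andP[qm mY'].
have m0 : 0 < m by lra.
have um1 : u m <= 1.
  have := kS m; rewrite (ltW m0) mY' => /(_ isT).
  by rewrite /u expRN -ler_pdivlMr ?expR_gt0// div1r.
(* If [u m < 1], the rate could be raised by [e'] on all of [[0, Y]]: below [q] thanks to [N], above
   [q] because [u y <= u m]. This contradicts the choice of [sup S]. *)
have gm : g m = expR (- (sup S * m ^+ 2)).
  apply/eqP; rewrite eq_le kS ?(ltW m0)//= leNgt; apply/negP => gm.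
  have {um1} um1 : u m < 1 by move: gm; rewrite expRN -div1r ltr_pdivlMr ?expR_gt0.
  have um0 : 0 < u m by rewrite mulr_gt0 ?expR_gt0// fixed_point_gt0// ltW.
  have lnu : 0 < - ln (u m) by rewrite oppr_gt0 ln_lt0// um0.
  pose e' := Num.min e (- ln (u m) / Y ^+ 2).
  have e'0 : 0 < e' by rewrite lt_min e0/= divr_gt0// exprn_gt0.
  have : S (sup S + e').
    split; first by rewrite addr_ge0// ltW.
    move=> y /andP[y0 yY].
    have [yq|qy] := ltP y q.
      move: y0; rewrite le_eqVlt => /orP[/eqP <-|y0]; first by rewrite g0 expr0n/= mulr0 oppr0 expR0.
      apply: le_trans (N y y0 (lt_trans yq qd) yY) _.
      by rewrite ler_expR lerN2 ler_wpM2r ?sqr_ge0// lerD2l ge_min lexx.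
    have : u y <= u m by apply: mM; rewrite in_itv/= qy.
    rewrite /u -ler_pdivlMr ?expR_gt0// -expRN => /le_trans; apply.
    rewrite -[X in X * _]lnK ?posrE// -expRD ler_expR mulrDl opprD addrC lerD2l.
    rewrite lerNr; apply: le_trans (_ : e' * Y ^+ 2 <= _).
      by rewrite ler_wpM2l ?(ltW e'0)// ler_sqr ?nnegrE ?(ltW Y0)//.
    by rewrite -ler_pdivlMr ?exprn_gt0// ge_min lexx orbT.
  move=> H; have : sup S + e' <= sup S by apply: ub_le_sup => //; case: hS.
  by rewrite gerDl leNgt e'0.
(* The angle [t] with [m * cos t = q / 2] lands where [N] makes the Gaussian bound strict. The
   equation at [m], whose integrand is nonnegative with zero integral, forces equality at that
   angle. *)
have [c0 c1] : 0 < q / 2 / m /\ q / 2 / m < 1.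
  split; first by apply: divr_gt0 => //; lra.
  by rewrite ltr_pdivrMr// mul1r; lra.
have [|t tI ct] := @quarter_cos_onto R (q / 2 / m); first by rewrite c0 c1.
have [_ _ st0 st1] := quarter_lt1 tI.
have bnd x : 0 <= x <= pi / 2 ->
    0 <= expR (- (sup S * m ^+ 2)) - g (m * cos x) * g (m * sin x).
  move=> /[dup] /quarter_cos/andP[ct0 ct1] /quarter_sin/andP[sx0 sx1].
  rewrite subr_ge0 -[m ^+ 2]mulr1 -(cos2Dsin2 x) mulrDr -!exprMn mulrDr opprD expRD.
  rewrite ler_pM//.
  - by apply/ltW/fixed_point_gt0; nra.
  - by apply/ltW/fixed_point_gt0; nra.
  - by apply: kS; apply/andP; split; nra.
  - by apply: kS; apply/andP; split; nra.
have : expR (- (sup S * m ^+ 2)) - g (m * cos t) * g (m * sin t) = 0.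
  apply: (@Rintegral_segment_eq0 R (fun x => expR (- (sup S * m ^+ 2)) - g (m * cos x) * g (m * sin x)) 0 (pi/2)) => //.
    by move=> x; apply: cvgB; [exact: cvg_cst|exact: cgg].
  rewrite RintegralB//; [|by apply: cont_integrable => ?; exact: cvg_cst|exact: cont_integrable].
  rewrite gE ?(ltW m0)// gm Rintegral_cst//= lebesgue_measure_itv/= lte_fin pi20/= subr0.
  by rewrite mulrC subrr.
apply/eqP; rewrite gt_eqF// subr_gt0 -[m ^+ 2]mulr1 -(cos2Dsin2 t) mulrDr -!exprMn mulrDr opprD expRD.
have -> : m * cos t = q / 2 by rewrite ct mulrC divfK// gt_eqF.
apply: (@le_lt_trans _ _ (expR (- ((sup S + e) * (q / 2) ^+ 2)) * expR (- (sup S * (m * sin t) ^+ 2)))).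
  apply: ler_pM.
  - by apply/ltW/fixed_point_gt0; lra.
  - by apply/ltW/fixed_point_gt0; nra.
  - by apply: N; lra.
  - by apply: kS; apply/andP; split; nra.
rewrite ltr_pM2r ?expR_gt0// ltr_expR ltrN2 mulrDl ltrDl mulr_gt0// exprn_gt0//; lra.
Qed.

End fixed_point.

(* [f] is the defect [exp (- k y^2) - g y]; [b^-1] bounds the range of [y]. *)
Section defect.
Context {R : realType}.
Notation mu := (@lebesgue_measure R).
Variables (f : R -> R) (b : R).
Hypothesis cf : continuous f.
Hypothesis b0 : 0 < b.
Hypothesis f01 : forall y : R, 0 <= y <= b^-1 -> 0 <= f y <= 1.
Hypothesis f_sub : forall y : R, 0 <= y <= b^-1 ->
  pi / 2 * f y <= 2 * \int[mu]_(t in `[0, pi / 2]) f (y * cos t).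

(* The maximum only makes [x * f x^-1] continuous on the whole line. *)
Let q (x : R) := Num.max x b * f (Num.max x b)^-1.

Let mx0 (x : R) : 0 < Num.max x b. Proof. by rewrite lt_max b0 orbT. Qed.

Let cmx : continuous (fun x : R => Num.max x b).
Proof. by move=> x; apply: continuous_max; [exact: cvg_id|exact: cvg_cst]. Qed.

Let cq : continuous q.
Proof.
move=> x; apply: cvgM; first exact: cmx.
apply: (@continuous_comp _ _ _ (fun x : R => (Num.max x b)^-1) f); last exact: cf.
by apply: cvgV; [rewrite gt_eqF|exact: cmx].
Qed.

Let qE x : b <= x -> q x = x * f x^-1.
Proof. by move=> bx; rewrite /q max_l. Qed.

Let fm x : 0 <= f (Num.max x b)^-1 <= 1.
Proof.
apply: f01; rewrite invr_ge0 (ltW (mx0 x))/= lef_pV2 ?posrE ?mx0//.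
by rewrite le_max lexx orbT.
Qed.

Let q_ge0 x : 0 <= q x.
Proof. by have /andP[f0 _] := fm x; rewrite /q mulr_ge0// ltW. Qed.

Let q_le x : q x <= Num.max x b.
Proof. by have /andP[_ f1] := fm x; rewrite /q ler_piMr// ltW. Qed.

Let K r := \int[mu]_(x in `[b, r]) q x.

Let KB r s : b <= r -> r <= s -> K s = K r + \int[mu]_(x in `[r, s]) q x.
Proof. by move=> br rs; rewrite /K (@Rintegral_split _ q b s r). Qed.

Let K_homo r s : b <= r -> r <= s -> K r <= K s.
Proof. by move=> br rs; rewrite (KB br rs) lerDl Rintegral_ge0. Qed.

Let dK x : b < x -> is_derive x 1 K (x * f x^-1).
Proof.
move=> bx; rewrite -qE ?ltW//.
by apply: (@derivable_Rintegral R q b (x + 1)) => //; rewrite ltrDl.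
Qed.

Let cK x : b < x -> {for x, continuous K}.
Proof.
move=> bx; apply: differentiable_continuous; apply/derivable1_diffP.
exact: (@ex_derive _ _ _ _ _ _ _ (dK bx)).
Qed.

Let K_ge0 r : 0 <= K r. Proof. exact: Rintegral_ge0. Qed.

Let K_le r : b <= r -> K r <= r ^+ 2.
Proof.
move=> br.
apply: (@le_trans _ _ (\int[mu]_(x in `[b, r]) r)).
  apply: le_Rintegral => //.
  - exact: cont_integrable.
  - by apply: cont_integrable => x; exact: cvg_cst.
  - move=> x /=; rewrite in_itv/= => /andP[bx xr].
    by apply: le_trans (q_le x) _; rewrite max_l.
rewrite Rintegral_cst//= lebesgue_measure_itv/= lte_fin.
have r0 : 0 < r by exact: lt_le_trans br.
case: ltP => _ /=; last by rewrite mulr0 sqr_ge0.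
by rewrite expr2 ler_wpM2l ?(ltW r0)// gerBl ltW.
Qed.

(** Differentiating [K (r / cos t)] in [r] produces one factor [1 / cos t] from the chain rule and
    one from [K' x = x * f x^-1]; the weight [cos t ^+ 2] removes both. *)
Let F r t := cos t ^+ 2 * (K (r / cos t) - K r).

Let divc_ge (r t : R) : 0 < r -> 0 <= t < pi / 2 -> r <= r / cos t.
Proof.
move=> r0 /[dup] /quarter_cos_gt0 c0 /andP[t0 t1].
have /quarter_cos/andP[_ c1] : 0 <= t <= pi / 2 by rewrite t0 ltW.
by rewrite ler_pdivlMr// ler_piMr// ltW.
Qed.

(** [r / cos t] is unbounded near [pi / 2], but [K] grows at most quadratically and [cos t ^+ 2]
    absorbs exactly that growth, which makes [J r] finite. *)
Let F_bnd (r t : R) : b <= r -> 0 <= t < pi / 2 -> 0 <= F r t <= r ^+ 2.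
Proof.
move=> br tI; have r0 : 0 < r by exact: lt_le_trans br.
have c0 := quarter_cos_gt0 tI; have rc := divc_ge r0 tI.
apply/andP; split; first by rewrite mulr_ge0 ?sqr_ge0// subr_ge0 K_homo.
apply: (@le_trans _ _ (cos t ^+ 2 * (r / cos t) ^+ 2)).
  rewrite ler_wpM2l ?sqr_ge0//; apply: (@le_trans _ _ (K (r / cos t))).
    by rewrite gerBl.
  by apply: K_le; exact: le_trans rc.
by rewrite -exprMn mulrC divfK// gt_eqF.
Qed.

Let cF (r t : R) : b < r -> 0 <= t < pi / 2 -> {for t, continuous (F r)}.
Proof.
move=> br tI; have r0 : 0 < r by exact: lt_trans br.
have c0 := quarter_cos_gt0 tI; have rc := divc_ge r0 tI.
apply: cvgM.
  apply: (@continuous_comp _ _ _ cos (fun x : R => x ^+ 2)); first exact: continuous_cos.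
  exact: exprn_continuous.
apply: cvgB; last exact: cvg_cst.
apply: (@continuous_comp _ _ _ (fun t : R => r / cos t) K).
  apply: cvgM; first exact: cvg_cst.
  by apply: cvgV; [rewrite gt_eqF|exact: continuous_cos].
by apply: cK; exact: lt_le_trans rc.
Qed.

(** The interval is open because [r / cos t] blows up at [pi / 2], so that continuity of [F r] is
    only available before that point. *)
Let B : set R := `]0, pi / 2[%classic.

Let BE (t : R) : B t -> 0 < t < pi / 2.
Proof. by rewrite /B /= in_itv. Qed.

Let BE' (t : R) : B t -> 0 <= t < pi / 2.
Proof. by move=> /BE /andP[/ltW -> ->]. Qed.

Let BB (t : R) : B t -> 0 <= t <= pi / 2.
Proof. by move=> /BE /andP[/ltW -> /ltW ->]. Qed.

Let mB : measurable B. Proof. exact: measurable_itv. Qed.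

Let pi20 : 0 < (pi / 2 : R). Proof. by rewrite divr_gt0// pi_gt0. Qed.

Let muB : mu B = (pi / 2)%:E.
Proof. by rewrite /B lebesgue_measure_itv/= lte_fin pi20 oppr0 adde0. Qed.

Let Rint_B h : continuous h ->
  \int[mu]_(t in B) h t = \int[mu]_(t in `[0, pi / 2]) h t.
Proof.
move=> ch; have hI := @cont_integrable R h 0 (pi / 2) ch.
rewrite /B Rintegral_itv_obnd_cbnd.
  rewrite Rintegral_itv_bndo_bndc//.
  by apply: integrableS hI => //; apply: subset_itv_co_cc.
by apply: integrableS hI => //; apply: subset_itv_oo_cc.
Qed.

Let B_int h : {in B, continuous h} -> (exists M, forall t, B t -> `|h t| <= M) ->
  mu.-integrable B (EFin \o h).
Proof.
move=> ch [M hM]; apply: measurable_bounded_integrable => //.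
- by rewrite [X in (X < _)%E]muB ltry.
- by apply: open_continuous_measurable_fun => //; exact: interval_open.
- exists M; split; first exact: num_real.
  by move=> x Mx t /= Bt; apply: le_trans (hM t Bt) (ltW Mx).
Qed.

Let F_int r : b < r -> mu.-integrable B (EFin \o F r).
Proof.
move=> br; apply: B_int.
  by move=> t; rewrite inE => Bt; apply: cF => //; exact: BE'.
exists (r ^+ 2) => t Bt; have /andP[F0 F1] := F_bnd (ltW br) (BE' Bt).
by rewrite ger0_norm.
Qed.

Let J r := \int[mu]_(t in B) F r t.

Let dF (r t : R) : b < r -> B t ->
  is_derive r 1 (F ^~ t) (r * (f (r^-1 * cos t) - cos t ^+ 2 * f r^-1)).
Proof.
move=> br Bt; have r0 : 0 < r by exact: lt_trans br.
have c0 := quarter_cos_gt0 (BE' Bt); have rc := divc_ge r0 (BE' Bt).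
have d1 : is_derive (r / cos t) 1 K (r / cos t * f (r / cos t)^-1).
  by apply: dK; exact: lt_le_trans rc.
have d2 : is_derive r 1 (fun r : R => r / cos t) (cos t)^-1.
  by apply: is_derive_eq; rewrite scaler0 add0r scaler1.
have d3 : is_derive r 1 K (r * f r^-1) by exact: dK.
have d4 := @is_derive1_comp R K (fun r : R => r / cos t) r _ _ d1 d2.
apply: (@is_derive_eq _ _ _ _ _ _ _ _ (is_deriveZ (cos t ^+ 2) (is_deriveB d4 d3))).
rewrite invfM invrK /GRing.scale/=; field.
by rewrite gt_eqF.
Qed.

Let int_cos2 : \int[mu]_(t in B) cos t ^+ 2 = pi / 4.
Proof.
have cs (h : R -> R) : continuous h -> continuous (fun t => h t ^+ 2).
  move=> ch t; apply: (@continuous_comp _ _ _ h (fun x : R => x ^+ 2)); first exact: ch.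
  exact: exprn_continuous.
rewrite Rint_B; last by apply: cs; exact: continuous_cos.
have := @Rintegral_cos_sin R (fun x : R => x ^+ 2) (@exprn_continuous _ 2).
have : \int[mu]_(t in `[0, pi / 2]) (cos t ^+ 2 + sin t ^+ 2) = pi / 2.
  under eq_Rintegral do rewrite cos2Dsin2.
  by rewrite Rintegral_cst//= lebesgue_measure_itv/= lte_fin pi20/= subr0 mul1r.
rewrite RintegralD//.
- by move=> + E; rewrite E; lra.
- by apply: cont_integrable; apply: cs; exact: continuous_cos.
- by apply: cont_integrable; apply: cs; exact: continuous_sin.
Qed.

Let cfc y : continuous (fun t => f (y * cos t)).
Proof. by apply: continuous_scale => //; exact: continuous_cos. Qed.

Let ccos2 : continuous (fun t : R => cos t ^+ 2).
Proof.
move=> t; apply: (@continuous_comp _ _ _ cos (fun x : R => x ^+ 2)); first exact: continuous_cos.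
exact: exprn_continuous.
Qed.

Let B_intc h : continuous h -> mu.-integrable B (EFin \o h).
Proof.
by move=> ch; apply: integrableS (@cont_integrable R h 0 (pi / 2) ch) => //; exact: subset_itv_oo_cc.
Qed.

(** Differentiation under the integral gives [J' r = r * (int f (r^-1 * cos t) - pi / 4 * f r^-1)],
    and [f_sub] at [y = r^-1] says that this is nonnegative. *)
Let dJ r : b < r -> derivable J r 1 /\ 0 <= J^`()%classic r.
Proof.
move=> br; have r0 : 0 < r by exact: lt_trans br.
have Ia : `]b, (r + 1)[%classic r by rewrite /= in_itv/= br ltrDl ltr01.
have IE x : `]b, (r + 1)[%classic x -> b < x < r + 1 by rewrite /= in_itv.
have intF x : `]b, (r + 1)[%classic x -> mu.-integrable B (EFin \o F x).
  by move=> /IE /andP[bx _]; exact: F_int.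
have derF x t : `]b, (r + 1)[%classic x -> B t -> derivable (F ^~ t) x 1.
  move=> /IE /andP[bx _] Bt; exact: (@ex_derive _ _ _ _ _ _ _ (dF bx Bt)).
(* The dominating constant: [x < r + 1], and each of the two terms in the bracket of [dF] is at most
   1 in absolute value. *)
have G0 (t : R) : 0 <= cst (2 * (r + 1)) t by rewrite /= mulr_ge0//; lra.
have intG : mu.-integrable B (EFin \o cst (2 * (r + 1))).
  apply: B_int; first by move=> t _; exact: cvg_cst.
  by exists (2 * (r + 1)) => t _; rewrite ger0_norm.
have pE x t : `]b, (r + 1)[%classic x -> B t ->
    partial1of2 F x t = x * (f (x^-1 * cos t) - cos t ^+ 2 * f x^-1).
  move=> /IE /andP[bx _] Bt; rewrite partial1of2E.
  exact: (@derive_val _ _ _ _ _ _ _ (dF bx Bt)).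
have Gub x t : `]b, (r + 1)[%classic x -> B t -> `|partial1of2 F x t| <= cst (2 * (r + 1)) t.
  move=> Ix Bt; rewrite pE//; have /andP[bx xr] := IE _ Ix.
  have x0 : 0 < x by exact: lt_trans bx.
  have x1 : 0 <= x^-1 <= b^-1 by rewrite invr_ge0 (ltW x0) lef_pV2 ?posrE// ltW.
  have /andP[c0 c1] := quarter_cos (BB Bt).
  have /andP[f0 f1] := f01 x1.
  have /andP[g0 g1] : 0 <= f (x^-1 * cos t) <= 1.
    by apply: f01; have /andP[? ?] := x1; apply/andP; split; nra.
  rewrite normrM (gtr0_norm x0) mulrC ler_pM ?(ltW x0) ?(ltW xr)//.
  rewrite (le_trans (ler_normB _ _))//.
  have c2 : 0 <= cos t ^+ 2 <= 1 by rewrite sqr_ge0 expr_le1.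
  have /andP[c20 c21] := c2.
  rewrite -[2]/(1 + 1) lerD//; first by rewrite ger0_norm.
  by rewrite ger0_norm ?mulr_ge0// mulr_ile1.
split.
  exact: (@derivable_under_integral R _ _ mu F B mB r b (r + 1) Ia intF derF _ G0 intG Gub).
rewrite (@differentiation_under_integral R _ _ mu F B mB r b (r + 1) Ia intF derF _ G0 intG Gub).
have -> : \int[mu]_(t in B) partial1of2 F r t =
    r * (\int[mu]_(t in B) f (r^-1 * cos t) - pi / 4 * f r^-1).
  rewrite -int_cos2 -RintegralZr//; last by apply: B_intc; exact: ccos2.
  have c3 : continuous (fun t => cos t ^+ 2 * f r^-1).
    by move=> t; apply: cvgM; [exact: ccos2|exact: cvg_cst].
  rewrite -RintegralB//; [|exact/B_intc/cfc|exact: B_intc].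
  rewrite -RintegralZl//; last first.
    by apply: B_intc => t; apply: cvgB; [exact: cfc|exact: c3].
  by apply: eq_Rintegral => t; rewrite inE => Bt; rewrite pE.
rewrite mulr_ge0 ?(ltW r0)// Rint_B// subr_ge0.
have := @f_sub r^-1; rewrite invr_ge0 (ltW r0) lef_pV2 ?posrE// (ltW br) => /(_ isT).
lra.
Qed.

Let J_homo r s : b < r -> r <= s -> J r <= J s.
Proof.
move=> br rs; apply: (@ger0_derive1_ndecr R J r s _ _ _ r s) => //.
- by move=> x; rewrite in_itv/= => /andP[rx _]; apply: (dJ _).1; exact: lt_trans rx.
- by move=> x; rewrite in_itv/= => /andP[rx _]; apply: (dJ _).2; exact: lt_trans rx.
- apply: derivable_within_continuous => x; rewrite in_itv/= => /andP[rx _].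
  by apply: (dJ _).1; exact: lt_le_trans rx.
Qed.

Let dW (r t : R) : b < r -> 0 <= t < pi / 2 -> is_derive t 1 (fun t => K (r / cos t) - K r)
  (r ^+ 2 * f (r^-1 * cos t) * sin t / cos t ^+ 3).
Proof.
move=> br tI; have r0 : 0 < r by exact: lt_trans br.
have c0 := quarter_cos_gt0 tI; have rc := divc_ge r0 tI.
have d1 : is_derive (r / cos t) 1 K (r / cos t * f (r / cos t)^-1).
  by apply: dK; exact: lt_le_trans rc.
have cn0 : cos t != 0 by rewrite gt_eqF.
have d2 : is_derive t 1 (fun t : R => r / cos t) (r * sin t / cos t ^+ 2).
  apply: (is_derive_eq (is_deriveZ r (is_deriveV cn0 (is_derive_cos t)))).
  by rewrite /GRing.scale/=; field.
have d4 := @is_derive1_comp R K (fun t : R => r / cos t) t _ _ d1 d2.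
have d5 : is_derive t 1 (cst (K r)) 0 by exact: is_derive_cst.
apply: (is_derive_eq (is_deriveB d4 d5)).
by rewrite invfM invrK; field.
Qed.

(** The segment lemmas ask for continuity on the whole line. Replacing [cos t] by its maximum with
    [cos a] keeps the divisor away from 0 and changes nothing on [[0, a]]. *)
Let F_ext (r a : R) : b < r -> 0 < a < pi / 2 ->
  exists2 F', continuous F' & forall t : R, 0 <= t <= a -> F' t = F r t.
Proof.
move=> br /andP[a0 a1]; have r0 : 0 < r by exact: lt_trans br.
have ca0 : 0 < cos a by apply: quarter_cos_gt0; rewrite ltW.
pose m t := Num.max (cos t) (cos a).
have m0 t : 0 < m t by rewrite lt_max ca0 orbT.
have m1 t : m t <= 1 by rewrite ge_max !cos_le1.
have mE t : 0 <= t <= a -> m t = cos t.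
  move=> /andP[t0 ta]; rewrite /m max_l//.
  rewrite leNgt ltr_cos ?in_itv/= ?t0 ?(ltW a0) -?leNgt//=; have := pi_gt0 R; lra.
have cm : continuous m.
  move=> x; apply: continuous_max; [exact: continuous_cos|exact: cvg_cst].
exists (fun t => m t ^+ 2 * (K (r / m t) - K r)); last by move=> t /mE tE; rewrite tE.
move=> t; apply: cvgM.
  apply: (@continuous_comp _ _ _ m (fun x : R => x ^+ 2)); first exact: cm.
  exact: exprn_continuous.
apply: cvgB; last exact: cvg_cst.
apply: (@continuous_comp _ _ _ (fun t : R => r / m t) K).
  apply: cvgM; first exact: cvg_cst.
  by apply: cvgV; [rewrite gt_eqF|exact: cm].
by apply: cK; apply: lt_le_trans br _; rewrite ler_pdivlMr// ler_piMr// ltW.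
Qed.

Let int_F_le (r a : R) : b < r -> 0 < a < pi / 2 ->
  \int[mu]_(t in `[0, a]) F r t <= 4 / 3 * r ^+ 2 * \int[mu]_(t in `[0, a]) f (r^-1 * cos t).
Proof.
move=> br /[dup] aI /andP[a0 a1]; have r0 : 0 < r by exact: lt_trans br.
have Ba : B a by rewrite /B /= in_itv.
have [F' cF' F'E] := F_ext br aI.
(* [M] is chosen so that [cos t ^+ 2 + M' t = - 4 cos t ^+ 2 sin t (1 - sin t) <= 0] and [M t * sin t / cos t ^+ 3 <= 4 / 3]; hence [G] below is nonincreasing. *)
pose M (t : R) := cos t * cos t * cos t * (4 / 3 - sin t).
pose W t := K (r / cos t) - K r.
pose G t := \int[mu]_(s in `[0, t]) F' s + M t * W t
  - 4 / 3 * r ^+ 2 * \int[mu]_(s in `[0, t]) f (r^-1 * cos s).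
have dM (t : R) : is_derive t 1 M (- (3 * cos t ^+ 2 * sin t * (4 / 3 - sin t) + cos t ^+ 4)).
  have dc := is_derive_cos t; have ds := is_derive_sin t.
  have d5 : is_derive t 1 (cst (4 / 3 : R)) 0 by exact: is_derive_cst.
  apply: (is_derive_eq (is_deriveM (is_deriveM (is_deriveM dc dc) dc) (is_deriveB d5 ds))).
  rewrite !fctE /GRing.scale/=. ring.
have cI t : 0 <= t <= a -> 0 <= t < pi / 2.
  by move=> /andP[-> ta]; rewrite (le_lt_trans ta).
have dG t : 0 < t < a -> is_derive t 1 G (F' t + (M t * (r ^+ 2 * f (r^-1 * cos t) * sin t / cos t ^+ 3)
   + W t * - (3 * cos t ^+ 2 * sin t * (4 / 3 - sin t) + cos t ^+ 4)) - 4 / 3 * r ^+ 2 * f (r^-1 * cos t)).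
  move=> /andP[t0 ta].
  have d1 : is_derive t 1 (fun t => \int[mu]_(s in `[0, t]) F' s) (F' t).
    exact: (@derivable_Rintegral R F' 0 a t t0 ta cF').
  have d2 := @derivable_Rintegral R _ 0 a t t0 ta (@cfc r^-1).
  have tI : 0 <= t < pi / 2 by apply: cI; rewrite !ltW.
  exact: (is_derive_eq (is_deriveB (is_deriveD d1 (is_deriveM (dM t) (dW br tI))) (is_deriveZ (4 / 3 * r ^+ 2) d2))).
have G0 : G 0 = 0.
  by rewrite /G /W cos0 divr1 subrr mulr0 addr0 set_itv1 !Rintegral_set1 mulr0 subrr.
have Ga : G a <= G 0.
  apply: (@ler0_derive1_nincr R G 0 a _ _ _ 0 a) => //; last exact: ltW.
  - by move=> t; rewrite in_itv/= => tI; exact: (@ex_derive _ _ _ _ _ _ _ (dG t tI)).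
  - move=> t; rewrite in_itv/= => tI; rewrite derive1E (@derive_val _ _ _ _ _ _ _ (dG t tI)).
    have tI' : 0 <= t <= a by have /andP[/ltW -> /ltW ->] := tI.
    have tI2 := cI _ tI'.
    have tI3 : 0 < t < pi / 2 by have /andP[-> ta] := tI; exact: lt_trans a1.
    have [c0 c1 s0 s1] := quarter_lt1 tI3.
    have fI : 0 <= r^-1 * cos t <= b^-1.
      apply/andP; split; first by rewrite mulr_ge0 ?invr_ge0 ?(ltW r0) ?(ltW c0).
      apply: (@le_trans _ _ r^-1); first by rewrite ler_piMr ?invr_ge0 ?(ltW r0) ?(ltW c1).
      by rewrite lef_pV2 ?posrE// ltW.
    have /andP[f0 _] := f01 fI.
    have w0 : 0 <= W t by rewrite subr_ge0 K_homo ?(ltW br)// divc_ge.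
    rewrite F'E// /F -/(W t).
    have -> : M t * (r ^+ 2 * f (r^-1 * cos t) * sin t / cos t ^+ 3) =
        (4 / 3 - sin t) * sin t * (r ^+ 2 * f (r^-1 * cos t)).
      by rewrite /M; field; rewrite gt_eqF.
    have r2f : 0 <= r ^+ 2 * f (r^-1 * cos t) by rewrite mulr_ge0 ?sqr_ge0.
    have -> : cos t ^+ 4 = cos t ^+ 2 * cos t ^+ 2 by ring.
    have -> : 4 / 3 * r ^+ 2 * f (r^-1 * cos t) = 4 / 3 * (r ^+ 2 * f (r^-1 * cos t)) by ring.
    move: (cos2Dsin2 t) r2f w0 s0 s1.
    move: (cos t) (sin t) (W t) (r ^+ 2 * f (r^-1 * cos t)) => c s w z cs z0 w0 s0 s1.
    have -> : c ^+ 2 = 1 - s ^+ 2 by rewrite -cs addrK.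
    have wz : 0 <= w * (s * (1 - s)) by rewrite mulr_ge0// mulr_ge0 ?subr_ge0 ?(ltW s0) ?(ltW s1).
    have sz : 0 <= z * (4 / 3 - (4 / 3 - s) * s).
      apply: mulr_ge0 => //; rewrite (_ : _ - _ = 4 / 3 * (1 - s) + s ^+ 2); last by ring.
      by rewrite addr_ge0 ?sqr_ge0//; lra.
    have s2 : 0 <= (1 - s ^+ 2) * (w * (s * (1 - s))) by rewrite mulr_ge0//; nra.
    lra.
  - have a0' : 0 <= a by exact: ltW.
    apply: within_continuousB; last first.
      move=> t; apply: cvgM; first exact: cvg_cst.
      by move: t; apply: parameterized_integral_continuous => //; apply: cont_integrable; exact: cfc.
    apply: within_continuousD.
      by apply: parameterized_integral_continuous => //; apply: cont_integrable.
    apply: derivable_within_continuous => t; rewrite in_itv/= => tI.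
    exact: (@ex_derive _ _ _ _ _ _ _ (is_deriveM (dM t) (dW br (cI _ tI)))).
have MW : 0 <= M a * W a.
  have /andP[c0 c1] := quarter_cos (BB Ba).
  rewrite mulr_ge0// ?subr_ge0 ?K_homo ?(ltW br)// ?divc_ge// ?(ltW a0)//.
  by rewrite !mulr_ge0//; have := sin_le1 a; lra.
have -> : \int[mu]_(t in `[0, a]) F r t = \int[mu]_(s in `[0, a]) F' s.
  by apply: eq_Rintegral => t; rewrite inE/= in_itv/= => /F'E.
move: Ga; rewrite G0 /G; lra.
Qed.

(** The limit [a --> pi / 2] from the left in [int_F_le]; both integrals depend continuously on
    their upper end. *)
Let J_le r : b < r -> J r <= 4 / 3 * r ^+ 2 * \int[mu]_(t in `[0, pi / 2]) f (r^-1 * cos t).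
Proof.
move=> br; pose h := F r \_ B.
have ih : mu.-integrable `[0, pi / 2] (EFin \o h).
  apply: (@integrableS _ _ _ mu setT) => //.
  rewrite -restrict_EFin; apply: (@integrable_mkcond _ _ _ mu B (EFin \o F r) _).1 => //; exact: F_int.
have JE : J r = \int[mu]_(t in `[0, pi / 2]) h t.
  rewrite /h -Rintegral_mkcondr; congr (\int[mu]_(t in _) _).
  by apply/esym/setIidr => t /BB; rewrite /= in_itv.
rewrite JE.
have c1 := parameterized_integral_cvg_at_left pi20 ih.
have c2 := parameterized_integral_cvg_at_left pi20 (@cont_integrable R _ 0 (pi / 2) (@cfc r^-1)).
have c3 : (4 / 3 * r ^+ 2 * parameterized_integral mu 0 x (fun t => f (r^-1 * cos t)))
    @[x --> (pi / 2)^'-] --> 4 / 3 * r ^+ 2 * parameterized_integral mu 0 (pi / 2) (fun t => f (r^-1 * cos t)).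
  by apply: cvgM; [exact: cvg_cst|exact: c2].
change (parameterized_integral mu 0 (pi / 2) h <= 4 / 3 * r ^+ 2 *
  parameterized_integral mu 0 (pi / 2) (fun t => f (r^-1 * cos t))).
have := ler_cvg_to c1 c3; apply.
near=> a.
have aI : 0 < a < pi / 2 by apply/andP; split; near: a; [exact: nbhs_left_gt|exact: nbhs_left_lt].
apply: le_trans (int_F_le br aI).
rewrite le_eqVlt; apply/orP; left; apply/eqP; apply: eq_Rintegral => t.
rewrite inE /= in_itv/= => /andP[t0 ta]; rewrite /h patchE; case: ifPn => // tB.
(* The restriction to the open interval sets the value at [t = 0] to 0, which is already the value
   of [F r] there since [cos 0 = 1]. *)
move: t0; rewrite le_eqVlt => /orP[/eqP <-|t0].
  by rewrite /F cos0 divr1 subrr mulr0.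
move: tB; rewrite notin_setE /B /= in_itv/= t0/= => /negP; rewrite -leNgt => H.
by have /andP[_] := aI; rewrite ltNge (le_trans H ta).
Unshelve. all: by end_near. Qed.

(** Once [J r = 0], the nonnegative continuous integrand vanishes, so [K (r / cos t) = K r] for all
    interior [t]. As [r / cos t] runs over all points beyond [r], [K] is constant there, and its
    derivative [x * f x^-1] is 0. *)
Lemma defect_eq0 :
  (forall d e : R, 0 < d -> 0 < e -> exists l, [/\ 0 < l, l < d &
    \int[mu]_(t in `[0, pi / 2]) f (l * cos t) <= e * l ^+ 2]) ->
  forall y, 0 < y < b^-1 -> f y = 0.
Proof.
move=> small.
have J0 r : b < r -> J r <= 0.
  move=> br; rewrite leNgt; apply/negP => Jr.
  have absurd23 : ~ J r <= 2 / 3 * J r by lra.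
  have r0 : 0 < r by exact: lt_trans br.
  (* The tolerance [J r / 2] turns the factor [4 / 3] of [J_le] into [2 / 3], which is less than 1:
     monotonicity then gives [J r <= 2 / 3 * J r]. *)
  have [|l [l0 lr Il]] := small r^-1 (J r / 2) _ (divr_gt0 Jr (ltr0n _ 2)); first by rewrite invr_gt0.
  have rl : r < l^-1 by rewrite -[r]invrK ltf_pV2 ?posrE ?invr_gt0.
  have H1 := J_homo br (ltW rl).
  have H2 := J_le (lt_trans br rl); rewrite invrK in H2.
  have H3 : 4 / 3 * l^-1 ^+ 2 * (J r / 2 * l ^+ 2) = 2 / 3 * J r.
    by field; rewrite gt_eqF.
  have H4 : 4 / 3 * l^-1 ^+ 2 * \int[mu]_(t in `[0, pi / 2]) f (l * cos t) <=
            4 / 3 * l^-1 ^+ 2 * (J r / 2 * l ^+ 2).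
    by rewrite ler_wpM2l// mulr_ge0 ?sqr_ge0//.
  have := le_trans H1 (le_trans H2 H4); rewrite H3; exact: absurd23.
have FJ r (a : R) : b < r -> 0 < a < pi / 2 -> F r a = 0.
  move=> br /[dup] aI /andP[a0 a1].
  (* [Rintegral_segment_eq0] concludes at interior points only, hence a segment reaching beyond
     [a]. *)
  pose a' := (a + pi / 2) / 2.
  have a'I : 0 < a' < pi / 2 by rewrite /a'; lra.
  have [F' cF' F'E] := F_ext br a'I.
  rewrite -F'E; last by rewrite /a'; lra.
  apply: (@Rintegral_segment_eq0 R F' 0 a') => //.
  - move=> t tI; rewrite F'E//; have /andP[t0 ta'] := tI; have /andP[_ a'2] := a'I.
    have tI2 : 0 <= t < pi / 2 by rewrite t0/= (le_lt_trans ta').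
    by have /andP[] := F_bnd (ltW br) tI2.
  - apply: le_trans (J0 r br).
    have -> : \int[mu]_(t in `[0, a']) F' t = \int[mu]_(t in `]0, a']) F r t.
      rewrite -(@Rintegral_itv_obnd_cbnd _ 0 (BRight a')).
        apply: eq_Rintegral => t; rewrite inE /= in_itv/= => /andP[t0 ta].
        by rewrite F'E// ltW.
      by apply: integrableS (@cont_integrable R F' 0 a' cF') => //; exact: subset_itv_oc_cc.
    have sB : `]0, a']%classic `<=` B.
      by apply: subset_itvl; rewrite bnd_simp; have /andP[] := a'I.
    have iF : mu.-integrable `]0, a'] (EFin \o F r) by apply: integrableS (F_int br).
    apply: fine_le; [exact: integrable_fin_num|exact: integrable_fin_num (F_int br)|].
    apply: ge0_subset_integral => //.
      exact: measurable_int (F_int br).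
    by move=> t /BE' tI; rewrite lee_fin; have /andP[] := F_bnd (ltW br) tI.
  - by rewrite a0/= /a'; lra.
move=> y /andP[y0 yb].
have by1 : b < y^-1 by rewrite -[b]invrK ltf_pV2 ?posrE ?invr_gt0.
pose r := (b + y^-1) / 2.
have br : b < r by rewrite /r; lra.
have r0 : 0 < r by exact: lt_trans br.
have ry : r < y^-1 by rewrite /r; lra.
have Kc x : r < x -> K x = K r.
  move=> rx; have x0 : 0 < x by exact: lt_trans rx.
  have [|t tI ct] := @quarter_cos_onto R (r / x).
    by rewrite divr_gt0//= ltr_pdivrMr// mul1r.
  have /eqP := FJ r t br tI; rewrite /F mulf_eq0 subr_eq0 ct.
  rewrite expf_eq0/= (gt_eqF (divr_gt0 r0 x0))/= invfM invrK mulrA divff ?mul1r; last by rewrite gt_eqF.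
  by move/eqP.
have d0 : is_derive y^-1 1 (cst (K r) : R -> R) 0 by exact: is_derive_cst.
have d1 := dK by1.
have : y^-1 * f y^-1^-1 = 0.
  rewrite -(@derive_val _ _ _ _ _ _ _ d1) -(@derive_val _ _ _ _ _ _ _ d0).
  apply: near_eq_derive; near=> x; apply: Kc.
  by near: x; exact: lt_nbhsr.
rewrite invrK => /eqP; rewrite mulf_eq0 invr_eq0 (gt_eqF y0)/= => /eqP.
exact.
Unshelve. all: by end_near. Qed.

End defect.

(** * Uniqueness for the fixed point equation *)

Section fixed_point_unique.
Context {R : realType}.
Notation mu := (@lebesgue_measure R).
Variable g : R -> R.
Hypothesis cg : continuous g.
Hypothesis g0 : g 0 = 1.
Hypothesis gle1 : forall y : R, g y <= 1.
Hypothesis gE : forall y : R, 0 <= y ->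
  \int[mu]_(t in `[0, pi / 2]) (g (y * cos t) * g (y * sin t)) = pi / 2 * g y.

Let ggt0 (y : R) : 0 <= y -> 0 < g y. Proof. exact: fixed_point_gt0. Qed.

Let pi20 : 0 < (pi / 2 : R). Proof. by rewrite divr_gt0// pi_gt0. Qed.

(** The rate is an infimum over a bounded range, so the defect is known to be nonnegative only up to
    [Y], and the constant [k] depends a priori on [Y]. *)
Lemma fixed_point_segment (Y : R) : 0 < Y -> exists2 k : R, 0 <= k &
  forall y, 0 < y < Y -> g y = expR (- (k * y ^+ 2)).
Proof.
move=> Y0; have [k [k0 gk rate]] := fixed_point_rate cg g0 gle1 gE Y0.
exists k => //.
pose E (y : R) := expR (- (k * y ^+ 2)).
pose D y := E y - g y.
have cE : continuous E.
  move=> y; apply: (@continuous_comp _ _ _ (fun y : R => - (k * y ^+ 2)) expR); last exact: continuous_expR.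
  by apply: cvgN; apply: cvgM; [exact: cvg_cst|exact: exprn_continuous].
have cD : continuous D by move=> y; apply: cvgB; [exact: cE|exact: cg].
have E01 y : 0 < E y <= 1.
  by rewrite expR_gt0/= -expR0 ler_expR oppr_le0 mulr_ge0 ?sqr_ge0.
have D01 y : 0 <= y <= Y -> 0 <= D y <= 1.
  move=> yI; rewrite subr_ge0 gk//=; have /andP[y0 _] := yI.
  by have := ggt0 y0; have := E01 y; rewrite /D; lra.
have cs t : 0 <= t <= pi / 2 -> forall y, 0 <= y -> y <= Y ->
    0 <= y * cos t <= Y /\ 0 <= y * sin t <= Y.
  move=> /[dup] /quarter_cos/andP[c0 c1] /quarter_sin/andP[s0 s1] y y0 yY.
  by split; apply/andP; split; nra.
(* [E] also solves the equation, because [E y = E (y * cos t) * E (y * sin t)]; the difference of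
   the two products is then telescoped. Both weights are at most 1, which yields [Dsub]. *)
have DE y : 0 <= y -> pi / 2 * D y = \int[mu]_(t in `[0, pi / 2])
    (E (y * cos t) * D (y * sin t) + g (y * sin t) * D (y * cos t)).
  move=> y0; rewrite /D mulrBr -gE//.
  have -> : pi / 2 * E y = \int[mu]_(t in `[0, pi / 2]) E y.
    by rewrite Rintegral_cst//= lebesgue_measure_itv/= lte_fin pi20/= subr0 mulrC.
  rewrite -RintegralB//.
  - apply: eq_Rintegral => t _.
    have -> : E y = E (y * cos t) * E (y * sin t).
      by rewrite /E -expRD -[in LHS](mulr1 (y ^+ 2)) -(cos2Dsin2 t) !exprMn; congr expR; ring.
    ring.
  - by apply: cont_integrable => t; exact: cvg_cst.
  - apply: cont_integrable => t; apply: cvgM; apply: continuous_scale => //.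
      exact: continuous_cos.
    exact: continuous_sin.
have cDc y : continuous (fun t => D (y * cos t)).
  by apply: continuous_scale => //; exact: continuous_cos.
have cDs y : continuous (fun t => D (y * sin t)).
  by apply: continuous_scale => //; exact: continuous_sin.
have cI y : continuous (fun t => E (y * cos t) * D (y * sin t) + g (y * sin t) * D (y * cos t)).
  move=> t; apply: cvgD; apply: cvgM; [|exact: cDs| |exact: cDc].
  - by apply: continuous_scale => //; exact: continuous_cos.
  - by apply: continuous_scale => //; exact: continuous_sin.
have Dcs y : \int[mu]_(t in `[0, pi / 2]) (D (y * sin t) + D (y * cos t)) =
    2 * \int[mu]_(t in `[0, pi / 2]) D (y * cos t).
  rewrite RintegralD//; [|exact/cont_integrable/cDs|exact/cont_integrable/cDc].
  have := @Rintegral_cos_sin R (fun x => D (y * x)).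
  rewrite mulr_natl mulr2n => ->//.
  by move=> x; apply: (@continuous_scale _ D id) => // z; exact: cvg_id.
have Dsub y : 0 <= y <= Y -> pi / 2 * D y <= 2 * \int[mu]_(t in `[0, pi / 2]) D (y * cos t).
  move=> /andP[y0 yY]; rewrite DE// -Dcs; apply: le_Rintegral => //.
  - exact/cont_integrable/cI.
  - by apply: cont_integrable => t; apply: cvgD; [exact: cDs|exact: cDc].
  move=> t /=; rewrite in_itv/= => tI.
  have [cI' sI] := cs t tI y y0 yY.
  have /andP[Dc _] := D01 _ cI'; have /andP[Ds _] := D01 _ sI.
  have /andP[_ E1] := E01 (y * cos t); have g1 := gle1 (y * sin t).
  by rewrite lerD// ler_piMl.
move=> y yY; apply/eqP; rewrite -subr_eq0 -oppr_eq0 opprB; apply/eqP.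
apply: (@defect_eq0 R D Y^-1) => //; rewrite ?invr_gt0 ?invrK//.
move=> d e d0 e0.
(* Within [r] of 0 both weights in [DE] are at least [1 / 2]. This gives a converse to [Dsub]: the
   integral of [D (l * cos t)] is at most [pi / 2 * D l], so it is enough that [D l] be small. The
   factor [pi / 2] explains the tolerance passed to [rate]. *)
have [r /= r0 Hr] : \forall x \near (0 : R), 2^-1 < g x.
  by apply: (cvgr_gt _ (@cg 0)); rewrite g0 invf_lt1// ltr1n.
have [||l [l0 ld lY Hl]] := rate (Num.min d r) (e / (pi / 2)).
- by rewrite lt_min d0.
- exact: divr_gt0.
move: ld; rewrite lt_min => /andP[ld lr].
exists l; split => //.
apply: (@le_trans _ _ (pi / 2 * D l)).
  rewrite DE ?(ltW l0)// -(@ler_pM2l _ 2)// -Dcs -RintegralZl//; last exact/cont_integrable/cI.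
  apply: le_Rintegral => //.
  - by apply: cont_integrable => t; apply: cvgD; [exact: cDs|exact: cDc].
  - by apply: cont_integrable => t; apply: cvgM; [exact: cvg_cst|exact: cI].
  move=> t /=; rewrite in_itv/= => tI.
  have [cI' sI] := cs t tI l (ltW l0) lY.
  have /andP[Dc _] := D01 _ cI'; have /andP[Ds _] := D01 _ sI.
  have /andP[c0 c1] := quarter_cos tI; have /andP[s0 s1] := quarter_sin tI.
  have gs : 2^-1 < g (l * sin t).
    by apply: Hr; rewrite /= sub0r normrN ger0_norm ?mulr_ge0 ?(ltW l0)//; nra.
  have gc : 2^-1 < g (l * cos t).
    by apply: Hr; rewrite /= sub0r normrN ger0_norm ?mulr_ge0 ?(ltW l0)//; nra.
  have Ec : 2^-1 <= E (l * cos t) by move: Dc; rewrite /D; lra.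
  by nra.
rewrite -(@ler_pM2l _ (pi / 2)^-1) ?invr_gt0// mulrA mulVf ?gt_eqF// mul1r.
have -> : (pi / 2)^-1 * (e * l ^+ 2) = e / (pi / 2) * l ^+ 2 by ring.
rewrite /D lerBlDl; apply: (@le_trans _ _ (expR (- ((k + e / (pi / 2)) * l ^+ 2)) + e / (pi / 2) * l ^+ 2)); last by rewrite lerD2r.
(* The lower bound on [g l] factors as [E l * expR (- w)], which is at least [E l * (1 - w)], hence
   at least [E l - w]. *)
set w := e / (pi / 2) * l ^+ 2.
have w0 : 0 <= w by rewrite mulr_ge0 ?sqr_ge0// divr_ge0 ?ltW.
rewrite mulrDl opprD expRD -/w -/(E l).
have := expR_ge1Dx (- w); have /andP[E0 E1] := E01 l.
nra.
Qed.

(** The constants found on two overlapping ranges agree, since the value of [g] at 1 determines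
    them. *)
Lemma fixed_point_unique : exists2 k : R, 0 <= k &
  forall y, 0 <= y -> g y = expR (- (k * y ^+ 2)).
Proof.
have [k k0 kE] := @fixed_point_segment 2 (ltr0n _ 2).
exists k => // y; rewrite le_eqVlt => /orP[/eqP <-|y0].
  by rewrite expr0n/= mulr0 oppr0 expR0.
have [|k' _ k'E] := @fixed_point_segment (1 + y); first by rewrite addr_gt0.
have -> : k = k'.
  have : expR (- (k * 1 ^+ 2)) = expR (- (k' * 1 ^+ 2)).
    by rewrite -k'E ?ltr01/= ?ltrDl// kE// ltr01 ltr1n.
  by move=> /expR_inj; rewrite expr1n !mulr1 => /oppr_inj.
by apply: k'E; rewrite y0 ltrDr ltr01.
Qed.

End fixed_point_unique.

(** * Stationary characteristic functions *)

Section power_functions.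
Context {R : realType}.
Implicit Types (p r x y t : R).

Lemma continuous_normr_powR r : 0 < r -> continuous (fun x : R => `|x| `^ r).
Proof.
move=> r0 x; have [->|x0] := eqVneq x 0.
  apply/cvgrPdist_lt => e e0; rewrite normr0 powR0 ?gt_eqF//.
  exists (e `^ r^-1); first by rewrite /= powR_gt0.
  move=> y /=; rewrite sub0r normrN => ye; rewrite sub0r normrN ger0_norm ?powR_ge0//.
  have -> : e = (e `^ r^-1) `^ r by rewrite -powRrM mulVf ?gt_eqF// powRr1// ltW.
  by apply: gt0_ltr_powR => //; rewrite nnegrE ?powR_ge0.
apply: (@cvg_comp _ _ _ (fun x : R => `|x|) (fun y : R => y `^ r) (nbhs x) (nbhs `|x|)).
  exact: norm_continuous.
suff : {for `|x|, continuous (fun y : R => y `^ r)} by [].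
apply: differentiable_continuous; apply/derivable1_diffP.
by apply: derivable_powR; rewrite in_itv/= normr_gt0 x0.
Qed.

Lemma continuous_mul_normr_powR p : 0 <= p -> continuous (fun x : R => x * `|x| `^ p).
Proof.
rewrite le_eqVlt => /orP[/eqP <-|p0].
  rewrite (_ : (fun x => _) = id); first by move=> x; exact: cvg_id.
  by apply/funext => x; rewrite powRr0 mulr1.
move=> x; apply: cvgM; first exact: cvg_id.
exact: continuous_normr_powR.
Qed.

(** Applied at a cosine or a sine, this shows that the substitution [|y| ^ (1 + p)] turns [c_] and
    [s_] into [cos] and [sin]. *)
Lemma normr_mul_powR p x : 0 <= p -> `|x * `|x| `^ p| = `|x| `^ (1 + p).
Proof.
move=> p0; rewrite normrM (ger0_norm (powR_ge0 _ _)).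
have [->|x0] := eqVneq x 0.
  by rewrite normr0 mul0r powR0// gt_eqF// ltr_wpDr.
by rewrite powRD ?normr_eq0 ?x0 ?implybT// powRr1.
Qed.

Lemma continuous_c_ p : 0 <= p -> continuous (@c_ R p).
Proof.
move=> p0 t; apply: (@continuous_comp _ _ _ cos (fun x => x * `|x| `^ p)).
  exact: continuous_cos.
exact: continuous_mul_normr_powR.
Qed.

Lemma continuous_s_ p : 0 <= p -> continuous (@s_ R p).
Proof.
move=> p0 t; apply: (@continuous_comp _ _ _ sin (fun x => x * `|x| `^ p)).
  exact: continuous_sin.
exact: continuous_mul_normr_powR.
Qed.

(** The reflections about [pi], [pi / 2] and [3 pi / 2]: the first flips the sign of the sine, the
    other two that of the cosine, and the last one maps [[pi, 2 pi]] to itself. *)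
Lemma cos_2piB t : cos (2 * pi - t) = cos t.
Proof. by rewrite addrC mulr_natl cosD2pi cosN. Qed.

Lemma sin_2piB t : sin (2 * pi - t) = - sin t.
Proof. by rewrite addrC mulr_natl sinD2pi sinN. Qed.

Lemma cos_piB t : cos (pi - t) = - cos t.
Proof. by rewrite addrC cosDpi cosN. Qed.

Lemma sin_piB t : sin (pi - t) = sin t.
Proof. by rewrite addrC sinDpi sinN opprK. Qed.

Lemma cos_3piB t : cos (pi + 2 * pi - t) = - cos t.
Proof. by rewrite -addrA addrC cosDpi cos_2piB. Qed.

Lemma sin_3piB t : sin (pi + 2 * pi - t) = sin t.
Proof. by rewrite -addrA addrC sinDpi sin_2piB opprK. Qed.

End power_functions.

Section charfun_properties.
Context {R : realType} (m : probability (measurableTypeR R) R).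

Lemma integrable_scale (h : R -> R) (y : R) : continuous h ->
  (forall x, `|h x| <= 1) -> m.-integrable setT (EFin \o (fun x : R => h (y * x))).
Proof.
move=> ch h1; apply: measurable_bounded_integrable => //.
- by rewrite [X in (X < _)%E]probability_setT ltry.
- apply: continuous_measurable_fun => x.
  by apply: (@continuous_scale R h id); [exact: ch|move=> ?; exact: cvg_id].
exists 1; split; first exact: num_real.
by move=> z z1 x _; exact: le_trans (h1 _) (ltW z1).
Qed.

Lemma continuous_Rintegral_scale (h : R -> R) : continuous h ->
  (forall x, `|h x| <= 1) -> continuous (fun xi : R => \int[m]_x h (xi * x)).
Proof.
move=> ch h1 xi.
have I : (xi - 1 < xi < xi + 1) by lra.
apply: (@continuity_under_integral R _ _ m (fun (xi x : R) => h (xi * x)) setT _ (xi - 1) (xi + 1) _ _ (cst 1)) => //.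
- by move=> y _; exact: integrable_scale.
- apply: aeW => x _; have hx : continuous (fun y : R => h (y * x)).
    move=> z; apply: (@continuous_comp _ _ _ (fun y : R => y * x) h); last exact: ch.
    by apply: cvgM; [exact: cvg_id|exact: cvg_cst].
  by move=> y _; exact: hx.
- exact: finite_measure_integrable_cst.
- by move=> y _; apply: aeW => x _; exact: h1.
- by rewrite inE/= in_itv/=.
Qed.

End charfun_properties.

Section stationary_charfun.
Context {R : realType} (m : probability (measurableTypeR R) R) (p : R).
Notation mu := (@lebesgue_measure R).
Hypothesis p0 : 0 <= p.
Hypothesis kac0 : forall xi : R, kac_rhs p (charfun m) xi = 0.

Let a (xi : R) := \int[m]_x cos (xi * x).
Let b (xi : R) := \int[m]_x sin (xi * x).

Let cos_norm := @cos_max R.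
Let sin_norm := @sin_max R.

Let ca : continuous a.
Proof. by apply: continuous_Rintegral_scale => //; exact: continuous_cos. Qed.

Let cb : continuous b.
Proof. by apply: continuous_Rintegral_scale => //; exact: continuous_sin. Qed.

Let aN (xi : R) : a (- xi) = a xi.
Proof. by apply: eq_Rintegral => x _; rewrite mulNr cosN. Qed.

Let a_norm (xi : R) : a `|xi| = a xi.
Proof. by case: (ger0P xi) => // _; rewrite aN. Qed.

Let bN (xi : R) : b (- xi) = - b xi.
Proof.
rewrite -[RHS]mulN1r -RintegralZl//; last by apply: integrable_scale => //; exact: continuous_sin.
by apply: eq_Rintegral => x _; rewrite mulNr sinN mulN1r.
Qed.

Let cac (y : R) : continuous (fun t => a (y * c_ p t)).
Proof. by apply: continuous_scale => //; exact: continuous_c_. Qed.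

Let cas (y : R) : continuous (fun t => a (y * s_ p t)).
Proof. by apply: continuous_scale => //; exact: continuous_s_. Qed.

Let cbc (y : R) : continuous (fun t => b (y * c_ p t)).
Proof. by apply: continuous_scale => //; exact: continuous_c_. Qed.

Let cbs (y : R) : continuous (fun t => b (y * s_ p t)).
Proof. by apply: continuous_scale => //; exact: continuous_s_. Qed.

Let pi0 : 0 < (pi : R). Proof. exact: pi_gt0. Qed.

Let kacE (xi : R) :
  (2 * pi)^-1 * \int[mu]_(t in `[0, 2 * pi])
     (a (xi * c_ p t) * a (xi * s_ p t) - b (xi * c_ p t) * b (xi * s_ p t)) = a xi /\
  (2 * pi)^-1 * \int[mu]_(t in `[0, 2 * pi])
     (a (xi * c_ p t) * b (xi * s_ p t) + b (xi * c_ p t) * a (xi * s_ p t)) = b xi.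
Proof.
have /eqP := kac0 xi; rewrite eq_complex /= => /andP[/eqP re /eqP im]; split.
  apply/eqP; rewrite -subr_eq0 -[X in _ == X]re mul0r subr0 //.
by apply/eqP; rewrite -subr_eq0 -[X in _ == X]im mul0r addr0.
Qed.

(** As [a] is even and [b] odd, the term with [b] at the sine is odd about [pi], and the term with
    [b] at the cosine is odd about the midpoint of each half period; all these integrals vanish. *)
Let b0 (xi : R) : b xi = 0.
Proof.
have [_ <-] := kacE xi.
have c1 : continuous (fun t => a (xi * c_ p t) * b (xi * s_ p t)).
  by move=> t; apply: cvgM; [exact: cac|exact: cbs].
have c2 : continuous (fun t => b (xi * c_ p t) * a (xi * s_ p t)).
  by move=> t; apply: cvgM; [exact: cbc|exact: cas].
rewrite RintegralD//; [|exact: cont_integrable..].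
rewrite Rintegral_odd ?add0r//; first last.
- by move=> t; rewrite ?add0r /c_ /s_ cos_2piB sin_2piB normrN mulNr mulrN bN mulrN.
- by rewrite mulr_ge0// ltW.
rewrite (@Rintegral_split R _ 0 (2 * pi) pi) ?(ltW pi0)//; last by have := pi0; lra.
rewrite Rintegral_odd ?(ltW pi0)//; last first.
  by move=> t; rewrite ?add0r /c_ /s_ cos_piB sin_piB normrN mulNr mulrN bN mulNr.
rewrite Rintegral_odd//; first by rewrite addr0 mulr0.
  by have := pi0; lra.
by move=> t; rewrite /c_ /s_ cos_3piB sin_3piB normrN mulNr mulrN bN mulNr.
Qed.

(** Only the product of real parts survives. It is invariant under both reflections, so the full
    circle contributes four times the quarter circle. *)
Let aE (xi : R) : \int[mu]_(t in `[0, pi / 2]) (a (xi * c_ p t) * a (xi * s_ p t)) = pi / 2 * a xi.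
Proof.
have [<- _] := kacE xi.
have c1 : continuous (fun t => a (xi * c_ p t) * a (xi * s_ p t)).
  by move=> t; apply: cvgM; [exact: cac|exact: cas].
under [in RHS]eq_Rintegral do rewrite !b0 mul0r subr0.
rewrite (@Rintegral_even R _ 0 (2 * pi))//; first last.
- by move=> t; rewrite ?add0r /c_ /s_ cos_2piB sin_2piB normrN mulNr mulrN aN.
- by rewrite mulr_ge0// ltW.
rewrite add0r [2 * pi]mulrC mulfK// (@Rintegral_even R _ 0 pi) ?(ltW pi0)//; last first.
  by move=> t; rewrite ?add0r /c_ /s_ cos_piB sin_piB normrN mulNr mulrN aN.
have cancel4 (q i : R) : q != 0 -> i = q / 2 * ((q * 2)^-1 * (2 * (2 * i))) by move=> ?; field.
by rewrite add0r; apply: cancel4; rewrite gt_eqF.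
Qed.

Lemma stationary_charfunE : exists2 k : R, 0 <= k &
  forall xi : R, charfun m xi = (expR (- (k * `|xi| `^ (2 / (1 + p)))))%:C%C.
Proof.
have p1 : 0 < 1 + p by rewrite ltr_wpDr.
pose g (y : R) := a (`|y| `^ (1 + p)).
have cg : continuous g.
  move=> y; apply: (@continuous_comp _ _ _ (fun y : R => `|y| `^ (1 + p)) a).
    exact: continuous_normr_powR.
  exact: ca.
have g0 : g 0 = 1.
  rewrite /g normr0 powR0 ?gt_eqF// /a.
  under eq_Rintegral do rewrite mul0r cos0.
  by rewrite Rintegral_cst//= probability_setT mul1r.
have gle1 (y : R) : g y <= 1.
  have -> : 1 = \int[m]_x (1 : R) by rewrite Rintegral_cst//= probability_setT mul1r.
  apply: le_Rintegral => //.
    by apply: integrable_scale => //; exact: continuous_cos.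
  exact: finite_measure_integrable_cst.
have gE (y : R) : 0 <= y ->
    \int[mu]_(t in `[0, pi / 2]) (g (y * cos t) * g (y * sin t)) = pi / 2 * g y.
  move=> y0; rewrite /g -aE; apply: eq_Rintegral => t; rewrite inE/= in_itv/= => tI.
  have q x : a (`|y * x| `^ (1 + p)) = a (`|y| `^ (1 + p) * (x * `|x| `^ p)).
    by rewrite -[RHS]a_norm [in RHS]normrM normr_mul_powR// [in RHS](ger0_norm (powR_ge0 _ _)) normrM powRM.
  by rewrite !q.
have [k k0 kE] := fixed_point_unique cg g0 gle1 gE.
exists k => // xi.
have -> : charfun m xi = (a xi +i* b xi)%C by [].
rewrite b0 complexr0; congr (_%:C)%C.
have -> : a xi = g (`|xi| `^ (1 + p)^-1).
  rewrite /g (ger0_norm (powR_ge0 _ _)) -powRrM mulVf ?gt_eqF// powRr1// a_norm//.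
rewrite kE ?powR_ge0//; congr (expR (- (k * _))).
by rewrite -powR_mulrn ?powR_ge0// -powRrM mulrC.
Qed.

End stationary_charfun.

(** * Fourier inversion *)

Section density.
Context {R : realType}.
Notation mu := (@lebesgue_measure R).
Variable f : R -> R.
Hypothesis f0 : forall x, 0 <= f x.
Hypothesis intf : mu.-integrable setT (EFin \o f).
Hypothesis f1 : \int[mu]_x f x = 1.

Definition density (V : set (measurableTypeR R)) : \bar R :=
  (\int[mu]_(x in V) (f x)%:E)%E.

Let density_set0 : density set0 = 0%E.
Proof. by rewrite /density integral_set0. Qed.

Let density_ge0 V : (0 <= density V)%E.
Proof. by apply: integral_ge0 => x _; rewrite lee_fin. Qed.

Let density_sigma_additive : semi_sigma_additive density.
Proof.
move=> A mA tA mUA; rewrite /density integral_bigcup//=; last first.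
  by apply: (integrableS _ _ (subsetT _)) => //; exact: intf.
apply: is_cvg_ereal_nneg_natsum_cond => n _ _.
by apply: integral_ge0 => x _; rewrite lee_fin.
Qed.

HB.instance Definition _ := isMeasure.Build _ _ _
  density density_set0 density_ge0 density_sigma_additive.

Let density_setT : density setT = 1%E.
Proof.
by rewrite /density -(fineK (integrable_fin_num _ intf))// -[fine _]/(\int[mu]_x f x) f1.
Qed.

HB.instance Definition _ := @Measure_isProbability.Build _ _ R density density_setT.

Let density_dominates : density `<< mu.
Proof.
apply/null_content_dominatesP => A mA muA0.
by apply: null_set_integral => //; apply: measurable_funTS; exact: measurable_int intf.
Qed.

(** The change of variables formula involves the Radon-Nikodym derivative of [density]; it equals
    [f] almost everywhere because both have the same integral over each measurable set. *)
Lemma density_probability : exists m : probability (measurableTypeR R) R,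
  forall h : R -> R, measurable_fun setT h -> (forall x, `|h x| <= 1) ->
  \int[m]_x h x = \int[mu]_x (h x * f x).
Proof.
exists density => h mh h1; congr fine.
have ih : (density : probability _ _).-integrable setT (EFin \o h).
  apply: measurable_bounded_integrable => //.
    by rewrite [X in (X < _)%E]probability_setT ltry.
  exists 1; split; first exact: num_real.
  by move=> z z1 x _; exact: le_trans (h1 _) (ltW z1).
rewrite -(Radon_Nikodym_change_of_variables density_dominates)//=.
apply: ae_eq_integral => //.
- apply: emeasurable_funM; first exact: measurable_int ih.
  apply: (measurable_int mu).
  by apply: Radon_Nikodym_integrable; exact: density_dominates.
- by apply/measurable_EFinP; apply: measurable_funM => //; apply/measurable_EFinP; exact: measurable_int intf.
- rewrite [X in ae_eq _ _ _ X](_ : _ = (fun x => (h x)%:E * (f x)%:E)%E); last first.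
    by apply/funext => x; rewrite EFinM.
  apply: ae_eqe_mul2l => /=.
  rewrite Radon_NikodymE//=.
  case: cid => /= g [g1 g2 g3].
  apply: integral_ae_eq => //=; first exact: measurable_int intf.
  by move=> E _ mE; rewrite -g3.
Qed.

End density.

(** * Limits, symmetry and Fubini on the whole line *)

Section integrals_on_the_line.
Context {R : realType}.
Notation mu := (@lebesgue_measure R).
Implicit Types (f g h a b : R -> R).

Lemma Rdominated_cvg (f_ : nat -> R -> R) f g :
  (forall n, measurable_fun setT (f_ n)) ->
  (forall x, f_ n x @[n --> \oo] --> f x) ->
  mu.-integrable setT (EFin \o g) -> (forall n x, `|f_ n x| <= g x) ->
  \int[mu]_x f_ n x @[n --> \oo] --> \int[mu]_x f x.
Proof.
move=> mf ff ig fg.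
have mF : measurable_fun setT (EFin \o f).
  apply: (@emeasurable_fun_cvg _ _ _ setT (fun n => EFin \o f_ n)).
    by move=> n; exact/measurable_EFinP.
  by move=> x _; apply: cvg_EFin; [exact: nearW|exact: ff].
have mF_ n : measurable_fun setT (EFin \o f_ n) by exact/measurable_EFinP.
have ffE : {ae mu, forall x, setT x ->
    (fun n => (EFin \o f_ n) x) @ \oo --> (EFin \o f) x}.
  by apply: aeW => x _; apply: cvg_EFin; [exact: nearW|exact: ff].
have fgE : {ae mu, forall x n, setT x -> (`|(EFin \o f_ n) x| <= (EFin \o g) x)%E}.
  by apply: aeW => x n _; rewrite lee_fin.
have [iF _ cF] := @dominated_convergence _ _ _ mu setT measurableT _ _ _ mF_ mF ffE ig fgE.
apply: fine_cvg; rewrite fineK; last exact: integrable_fin_num.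
exact: cF.
Qed.

Lemma Rintegral_cvg_segment h : mu.-integrable setT (EFin \o h) ->
  \int[mu]_(x in `[- n%:R, n%:R]) h x @[n --> \oo] --> \int[mu]_x h x.
Proof.
move=> ih.
have -> : (fun n : nat => \int[mu]_(x in `[- n%:R, n%:R]) h x) =
    (fun n : nat => \int[mu]_x (h \_ `[- n%:R, n%:R]) x).
  by apply/funext => n; rewrite Rintegral_mkcond.
apply: (@Rdominated_cvg _ _ (fun x => `|h x|)).
- move=> n; apply/(measurable_restrictT _ _).1 => //.
  by apply: measurable_funTS; apply/measurable_EFinP; exact: measurable_int ih.
- move=> x; apply: cvg_near_cst; near=> n; rewrite patchE mem_set//=.
  rewrite in_itv/= -ler_norml; near: n; exact: nbhs_infty_ger.
- exact: integrable_norm ih.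
- by move=> n x; rewrite patchE; case: ifPn => // _; rewrite normr0.
Unshelve. all: by end_near. Qed.

Lemma Rintegral_line_odd h : mu.-integrable setT (EFin \o h) -> continuous h ->
  (forall x, h (- x) = - h x) -> \int[mu]_x h x = 0.
Proof.
move=> ih ch oh; have := Rintegral_cvg_segment ih.
have -> : (fun n : nat => \int[mu]_(x in `[- n%:R, n%:R]) h x) = cst 0.
  apply/funext => n; apply: Rintegral_odd => //; first by rewrite ge0_cp.
  by move=> x; rewrite addNr sub0r oh.
by move=> H; apply/esym/(cvg_unique _ (cvg_cst 0) H).
Qed.

Lemma Rintegral_line_derive h h' : mu.-integrable setT (EFin \o h') -> continuous h' ->
  (forall x : R, is_derive x 1 h (h' x)) ->
  h n%:R - h (- n%:R) @[n --> \oo] --> 0 -> \int[mu]_x h' x = 0.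
Proof.
move=> ih ch' dh h0; have := Rintegral_cvg_segment ih.
suff H : {near \oo, (fun n : nat => \int[mu]_(x in `[- n%:R, n%:R]) h' x) =1
    (fun n : nat => h n%:R - h (- n%:R))}.
  by move=> /(cvg_trans (near_eq_cvg H)) H1; apply/esym/(cvg_unique _ h0 H1).
near=> n.
have n0 : (0 < n)%N by near: n; exact: nbhs_infty_gt.
have ch : continuous h.
  move=> x; apply: differentiable_continuous; apply/derivable1_diffP.
  exact: (@ex_derive _ _ _ _ _ _ _ (dh x)).
rewrite /Rintegral (@continuous_FTC2 _ _ h)//.
- by rewrite -subr_gt0 opprK addr_gt0 ?ltr0n.
- by apply: continuous_subspaceT => x; exact: ch'.
- split.
  + by move=> x _; exact: (@ex_derive _ _ _ _ _ _ _ (dh x)).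
  + by apply: cvg_at_right_filter; exact: ch.
  + by apply: cvg_at_left_filter; exact: ch.
- by move=> x _; rewrite derive1E (@derive_val _ _ _ _ _ _ _ (dh x)).
Unshelve. all: by end_near. Qed.

(** Fubini, dominated by [|a x| * |b y|], whose iterated integral factors. The kernel will be a
    product of two cosines, both in the inversion formula and for mixtures. *)
Lemma Rintegral_swap a b (k : R * R -> R) :
  mu.-integrable setT (EFin \o a) -> mu.-integrable setT (EFin \o b) ->
  measurable_fun setT k -> (forall z, `|k z| <= 1) ->
  \int[mu]_x (a x * \int[mu]_y (b y * k (x, y))) =
  \int[mu]_y (b y * \int[mu]_x (a x * k (x, y))).
Proof.
move=> ia ib mk k1.
have ma : measurable_fun setT a by apply/measurable_EFinP; exact: measurable_int ia.
have mb : measurable_fun setT b by apply/measurable_EFinP; exact: measurable_int ib.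
pose F (z : R * R) : \bar R := (a z.1 * b z.2 * k z)%:E.
have mF : measurable_fun setT F.
  apply/measurable_EFinP; apply: measurable_funM => //.
  by apply: measurable_funM;
    [exact: measurableT_comp ma measurable_fst|exact: measurableT_comp mb measurable_snd].
have mk1 x : measurable_fun setT (fun y => k (x, y)) by exact: measurable_fun_pair2.
have mk2 y : measurable_fun setT (fun x => k (x, y)) by exact: measurable_fun_pair1.
have mbk x : measurable_fun setT (EFin \o (fun y => b y * k (x, y))).
  by apply/measurable_EFinP; apply: measurable_funM.
have mak y : measurable_fun setT (EFin \o (fun x => a x * k (x, y))).
  by apply/measurable_EFinP; apply: measurable_funM.
have ib1 x : mu.-integrable setT (EFin \o (fun y => b y * k (x, y))).
  apply: (le_integrable _ _ _ ib) => //.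
    exact: mbk.
  by move=> y _ /=; rewrite lee_fin normrM ler_piMr.
have ia1 y : mu.-integrable setT (EFin \o (fun x => a x * k (x, y))).
  apply: (le_integrable _ _ _ ia) => //.
    exact: mak.
  by move=> x _ /=; rewrite lee_fin normrM ler_piMr.
have iF : (mu \x mu)%E.-integrable setT F.
  pose G (z : R * R) : \bar R := (`|a z.1| * `|b z.2|)%:E.
  have iG : (mu \x mu)%E.-integrable setT G.
    apply/integrable12ltyP.
      apply/measurable_EFinP; apply: measurable_funM.
        by apply: measurableT_comp => //; exact: measurableT_comp ma measurable_fst.
      by apply: measurableT_comp => //; exact: measurableT_comp mb measurable_snd.
    rewrite /G /=.
    have -> : (\int[mu]_x \int[mu]_y `|(`|a x| * `|b y|)%:E| =
        \int[mu]_x ((`|a x|)%:E * (\int[mu]_y `|b y|)%:E))%E.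
      apply: eq_integral => x _.
      rewrite fineK; last exact: integrable_fin_num (integrable_norm ib).
      rewrite -integralZl//; last exact: integrable_norm ib.
      by apply: eq_integral => y _; rewrite /= normrM !normr_id.
    rewrite integralZr//; last exact: integrable_norm ia.
    by rewrite -(fineK (integrable_fin_num _ (integrable_norm ia)))// -EFinM ltry.
  apply: (le_integrable _ _ _ iG) => // z _.
  by rewrite /F /G /= lee_fin !normrM !normr_id ler_piMr// mulr_ge0.
have := Fubini iF; rewrite /F /= => H.
rewrite /Rintegral; congr fine.
transitivity (\int[mu]_x \int[mu]_y (a x * b y * k (x, y))%:E)%E.
  apply: eq_integral => x _; rewrite EFinM fineK; last exact: integrable_fin_num (ib1 x).
  rewrite -integralZl//; last exact: ib1.
  by apply: eq_integral => y _; rewrite -EFinM mulrA.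
rewrite H; apply: eq_integral => y _; rewrite EFinM fineK; last exact: integrable_fin_num (ia1 y).
rewrite -integralZl//; last exact: ia1.
by apply: eq_integral => x _; rewrite -EFinM mulrCA mulrA.
Qed.

End integrals_on_the_line.

(** * Gaussian functions and their Fourier transform *)

Section gaussian.
Context {R : realType}.
Notation mu := (@lebesgue_measure R).

(** Stated for nonnegative [G] with extended values, so that it can be used to establish
    integrability. *)
Lemma integral_affine (G : R -> R) (l t : R) : 0 < l -> continuous G -> (forall x, 0 <= G x) ->
  (\int[mu]_x (G x)%:E = \int[mu]_x (G (t + l * x) * l)%:E)%E.
Proof.
move=> l0 cG G0; pose F (x : R) := (x + t / l) * l.
have dF (x : R) : is_derive x 1 F l.
  have d1 : is_derive x 1 (cst (t / l) : R -> R) 0 by exact: is_derive_cst.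
  have d2 : is_derive x 1 (cst l : R -> R) 0 by exact: is_derive_cst.
  apply: (is_derive_eq (is_deriveM (is_deriveD (is_derive_id x (1 : R)) d1) d2)).
  by rewrite /GRing.scale/=; ring.
have F'E : F^`()%classic = cst l.
  by apply/funext => x; rewrite derive1E (@derive_val _ _ _ _ _ _ _ (dF x)).
rewrite (@increasing_ge0_integration_by_substitutionT R F G) ?F'E//.
- apply: eq_integral => x _; suff -> : t + l * x = F x by [].
  by rewrite /F; field; rewrite gt_eqF.
- by move=> x y xy; rewrite /F ltr_pM2r// ltrD2r.
- by move=> x; exact: cvg_cst.
- exact: is_cvg_cst.
- exact: is_cvg_cst.
- apply/gt0_cvgMlNy => //; exact: cvg_addrr_Ny.
- apply/gt0_cvgMly => //; exact: cvg_addrr.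
Qed.

Definition gaussian (c x : R) := expR (- (c * x ^+ 2)).

Lemma continuous_gaussian c : continuous (gaussian c).
Proof.
move=> x; apply: (@continuous_comp _ _ _ (fun y : R => - (c * y ^+ 2)) expR); last exact: continuous_expR.
by apply: cvgN; apply: cvgM; [exact: cvg_cst|exact: exprn_continuous].
Qed.

Lemma gaussian_gt0 c x : 0 < gaussian c x. Proof. exact: expR_gt0. Qed.

Lemma gaussian_le1 c x : 0 <= c -> gaussian c x <= 1.
Proof. by move=> c0; rewrite -expR0 ler_expR oppr_le0 mulr_ge0 ?sqr_ge0. Qed.

Lemma gaussianN c x : gaussian c (- x) = gaussian c x.
Proof. by rewrite /gaussian sqrrN. Qed.

Lemma integral_gaussian c : 0 < c ->
  (\int[mu]_x (gaussian c x)%:E = (Num.sqrt pi / Num.sqrt c)%:E)%E.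
Proof.
move=> c0.
rewrite (@integral_affine _ (Num.sqrt c)^-1 0) ?invr_gt0 ?sqrtr_gt0//; first last.
- by move=> x; rewrite ltW ?gaussian_gt0.
- exact: continuous_gaussian.
have gE (x : R) : gaussian c (0 + (Num.sqrt c)^-1 * x) = gauss_fun x.
  rewrite /gaussian /gauss_fun add0r exprMn exprVn sqr_sqrtr ?(ltW c0)//.
  by rewrite mulrA divff ?mul1r// gt_eqF.
under eq_integral do rewrite gE mulrC EFinM.
rewrite integralZl//; last exact: integrableT_gauss.
by rewrite integralT_gauss -EFinM [in LHS]mulrC.
Qed.

Lemma integrable_gaussian c : 0 < c -> mu.-integrable setT (EFin \o gaussian c).
Proof.
move=> c0; apply/integrableP; split.
  by apply/measurable_EFinP; apply: continuous_measurable_fun; exact: continuous_gaussian.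
under eq_integral do rewrite /= ger0_norm ?expR_ge0//.
by rewrite integral_gaussian// ltry.
Qed.

(** The Gaussian is a product of two equal halves: one absorbs [|x|] through [1 + c / 2 * x ^+ 2 <=
    expR (c / 2 * x ^+ 2)], the other remains as an integrable majorant. *)
Lemma integrable_id_gaussian c : 0 < c -> mu.-integrable setT (EFin \o (fun x => x * gaussian c x)).
Proof.
move=> c0.
have H := integrableZl measurableT (1 + 2 / c) (integrable_gaussian (divr_gt0 c0 (ltr0n _ 2))).
apply: (le_integrable _ _ _ H) => //.
  apply/measurable_EFinP; apply: measurable_funM => //.
  by apply: continuous_measurable_fun; exact: continuous_gaussian.
move=> x _ /=; rewrite lee_fin !normrM !(gtr0_norm (gaussian_gt0 _ _)).
have c2 : 0 < 1 + 2 / c by rewrite addr_gt0// divr_gt0.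
rewrite (gtr0_norm c2).
have -> : gaussian c x = gaussian (c / 2) x * gaussian (c / 2) x.
  by rewrite /gaussian -expRD; congr expR; field.
rewrite mulrA ler_pM2r ?gaussian_gt0// /gaussian expRN ler_pdivrMr ?expR_gt0//.
apply: (@le_trans _ _ ((1 + 2 / c) * (1 + c / 2 * x ^+ 2))); last first.
  by rewrite ler_wpM2l ?expR_ge1Dx// ltW// addr_gt0// divr_gt0.
apply: (@le_trans _ _ (1 + x ^+ 2)).
  rewrite -(real_normK (num_real x)); have := normr_ge0 x; nra.
have -> : (1 + 2 / c) * (1 + c / 2 * x ^+ 2) = 1 + x ^+ 2 + (2 / c + c / 2 * x ^+ 2).
  by field; rewrite gt_eqF.
have h1 : 0 <= 2 / c by rewrite divr_ge0// ltW.
have h2 : 0 <= c / 2 * x ^+ 2 by rewrite mulr_ge0 ?sqr_ge0// divr_ge0// ltW.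
by rewrite lerDl addr_ge0.
Qed.

Lemma continuous_scaled (h : R -> R) (y : R) : continuous h -> continuous (fun x : R => h (y * x)).
Proof.
move=> ch x; apply: (@continuous_comp _ _ _ (fun x : R => y * x) h); last exact: ch.
by apply: cvgM; [exact: cvg_cst|exact: cvg_id].
Qed.

Lemma integrable_bounded_mulM (a h : R -> R) (M : R) : mu.-integrable setT (EFin \o a) ->
  continuous h -> (forall x, `|h x| <= M) ->
  mu.-integrable setT (EFin \o (fun x => a x * h x)).
Proof.
move=> ia ch hM.
have ma : measurable_fun setT a by apply/measurable_EFinP; exact: measurable_int ia.
have m1 : measurable_fun setT (EFin \o (fun x => a x * h x)).
  by apply/measurable_EFinP; apply: measurable_funM => //; exact: continuous_measurable_fun.
apply: (le_integrable _ _ _ (integrableZl measurableT M ia)) => //.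
move=> x _ /=; rewrite lee_fin !normrM mulrC ler_wpM2r//.
by apply: le_trans (hM x) _; rewrite ler_norm.
Qed.

Lemma integrable_bounded_mul (a h : R -> R) : mu.-integrable setT (EFin \o a) ->
  continuous h -> (forall x, `|h x| <= 1) ->
  mu.-integrable setT (EFin \o (fun x => a x * h x)).
Proof. by move=> ia ch h1; exact: (integrable_bounded_mulM ia ch h1). Qed.

Lemma is_derive_gaussian c x :
  is_derive (x : R) (1 : R) (gaussian c) (- (2 * c * x) * gaussian c x).
Proof.
have d1 : is_derive x 1 (fun x : R => - (c * x ^+ 2)) (- (2 * c * x)).
  apply: (is_derive_eq (is_deriveN (is_deriveZ c (is_deriveX 2 (is_derive_id x (1 : R)))))).
  by rewrite /GRing.scale/= expr1; ring.
by apply: (is_derive_eq (is_derive1_comp (is_derive_expR _) d1)); rewrite mulrC.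
Qed.

Lemma is_derive_sin_scale (y x : R) : is_derive x 1 (fun x : R => sin (y * x)) (y * cos (y * x)).
Proof.
have d1 : is_derive x 1 (fun x : R => y * x) y.
  by apply: (is_derive_eq (is_deriveZ y (is_derive_id x (1 : R)))); rewrite /GRing.scale/= mulr1.
by apply: (is_derive_eq (is_derive1_comp (is_derive_sin _) d1)); rewrite mulrC.
Qed.

Lemma gaussian_le_inv c x : 0 < c -> x != 0 -> gaussian c x <= c^-1 * x ^- 2.
Proof.
move=> c0 x0; rewrite /gaussian expRN -invfM lef_pV2 ?posrE ?expR_gt0//; last first.
  by rewrite mulr_gt0// exprn_even_gt0.
by apply: le_trans (expR_ge1Dx _); rewrite lerDr.
Qed.

(** The derivative of [gaussian c x * sin (t * x)] has integral 0 over the line. *)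
Lemma gaussian_by_parts c t : 0 < c ->
  2 * c * \int[mu]_x (x * gaussian c x * sin (t * x)) =
  t * \int[mu]_x (gaussian c x * cos (t * x)).
Proof.
move=> c0.
have i1 : mu.-integrable setT (EFin \o (fun x => x * gaussian c x * sin (t * x))).
  apply: integrable_bounded_mul; first exact: integrable_id_gaussian.
    by apply: continuous_scaled; exact: continuous_sin.
  by move=> x; exact: sin_max.
have i2 : mu.-integrable setT (EFin \o (fun x => gaussian c x * cos (t * x))).
  apply: integrable_bounded_mul; first exact: integrable_gaussian.
    by apply: continuous_scaled; exact: continuous_cos.
  by move=> x; exact: cos_max.
have i1' := integrableZl measurableT (2 * c) i1.
have i2' := integrableZl measurableT t i2.
have cx (h : R -> R) : continuous h -> continuous (fun x => h (t * x)) by exact: continuous_scaled.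
apply/esym/eqP; rewrite -subr_eq0 -!RintegralZl// -RintegralB//; apply/eqP.
apply: (@Rintegral_line_derive R (fun x => gaussian c x * sin (t * x))).
- exact: (integrableB measurableT i2' i1').
- move=> x; apply: cvgB; apply: cvgM; try exact: cvg_cst; apply: cvgM.
  + exact: continuous_gaussian.
  + by apply: cx; exact: continuous_cos.
  + by apply: cvgM; [exact: cvg_id|exact: continuous_gaussian].
  + by apply: cx; exact: continuous_sin.
- move=> x; apply: (is_derive_eq (is_deriveM (is_derive_gaussian c x) (is_derive_sin_scale t x))).
  by rewrite /GRing.scale/=; ring.
- apply: norm_cvg0.
  apply: (@squeeze_cvgr _ _ _ _ (cst 0) (fun n : nat => 2 * c^-1 * n%:R^-1)); last 2 first.
  + exact: cvg_cst.
  + rewrite -[X in _ --> X](mulr0 (2 * c^-1)); apply: cvgM; first exact: cvg_cst.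
    by rewrite -cvg_shiftS; exact: cvg_harmonic.
  near=> n; rewrite normr_ge0/=.
  have n0 : (0 < n)%N by near: n; exact: nbhs_infty_gt.
  have nn (x : R) : `|x| = n%:R -> `|gaussian c x * sin (t * x)| <= c^-1 * n%:R^-1.
    move=> xn; have x0 : x != 0 by rewrite -normr_eq0 xn pnatr_eq0 -lt0n.
    rewrite normrM (gtr0_norm (gaussian_gt0 _ _)).
    apply: (@le_trans _ _ (gaussian c x)); first by rewrite ler_piMr ?sin_max ?(ltW (gaussian_gt0 _ _)).
    apply: le_trans (gaussian_le_inv c0 x0) _.
    rewrite ler_pM2l ?invr_gt0// -real_normK ?num_real// xn lef_pV2 ?posrE ?exprn_gt0 ?ltr0n//.
    by rewrite -natrX ler_nat -[X in (X <= _)%N]expn1 leq_pexp2l.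
  apply: (le_trans (ler_normB _ _)); rewrite -mulrA mulr_natl mulr2n.
  by rewrite lerD ?nn ?normrN ?normr_nat.
Unshelve. all: by end_near. Qed.

(** Differentiating under the integral and integrating by parts, the transform [H] satisfies
    [H' t = - (t / (2 * c)) * H t]. Hence [H t * expR ((4 * c)^-1 * t ^+ 2)] is constant, equal to
    the Gaussian integral [H 0]. *)
Lemma gaussian_FT c t : 0 < c ->
  \int[mu]_x (gaussian c x * cos (t * x)) =
  Num.sqrt pi / Num.sqrt c * gaussian (4 * c)^-1 t.
Proof.
move=> c0.
pose H (t : R) := \int[mu]_x (gaussian c x * cos (t * x)).
have dct (y x : R) : is_derive y 1 (fun t : R => gaussian c x * cos (t * x)) (- (x * gaussian c x * sin (y * x))).
  have d1 : is_derive y 1 (fun t : R => t * x) x.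
    have -> : (fun t : R => t * x) = (fun t : R => x * t) by apply/funext => z; rewrite mulrC.
    by apply: (is_derive_eq (is_deriveZ x (is_derive_id y (1 : R)))); rewrite /GRing.scale/= mulr1.
  apply: (is_derive_eq (is_deriveZ (gaussian c x) (is_derive1_comp (is_derive_cos _) d1))).
  by rewrite /GRing.scale/=; ring.
have dH (y : R) : is_derive y 1 H (- (y / (2 * c)) * H y).
  pose f (t x : R) := gaussian c x * cos (t * x).
  have Ia : `]y - 1, y + 1[%classic y by rewrite /= in_itv/=; lra.
  have intf x : `]y - 1, y + 1[%classic x -> mu.-integrable setT (EFin \o f x).
    move=> _; apply: integrable_bounded_mul; first exact: integrable_gaussian.
      by apply: continuous_scaled; exact: continuous_cos.
    by move=> z; exact: cos_max.
  have derf z x : `]y - 1, y + 1[%classic z -> [set: R] x -> derivable (f ^~ x) z 1.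
    by move=> _ _; exact: (@ex_derive _ _ _ _ _ _ _ (dct z x)).
  pose G x := `|x * gaussian c x|.
  have G0 x : 0 <= G x by exact: normr_ge0.
  have iG : mu.-integrable setT (EFin \o G) by apply: integrable_norm; exact: integrable_id_gaussian.
  have pE z x : partial1of2 f z x = - (x * gaussian c x * sin (z * x)).
    by rewrite partial1of2E; exact: (@derive_val _ _ _ _ _ _ _ (dct z x)).
  have Gub z x : `]y - 1, y + 1[%classic z -> [set: R] x -> `|partial1of2 f z x| <= G x.
    by move=> _ _; rewrite pE normrN normrM ler_piMr// sin_max.
  apply: DeriveDef.
    exact: (@derivable_under_integral R _ _ mu f setT measurableT y (y - 1) (y + 1) Ia intf derf _ G0 iG Gub).
  rewrite -derive1E (@differentiation_under_integral R _ _ mu f setT measurableT y (y - 1) (y + 1) Ia intf derf _ G0 iG Gub).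
  under eq_Rintegral do rewrite pE -mulN1r.
  rewrite RintegralZl//; last first.
    apply: integrable_bounded_mul; first exact: integrable_id_gaussian.
      by apply: continuous_scaled; exact: continuous_sin.
    by move=> x; exact: sin_max.
  have := gaussian_by_parts y c0; rewrite -/(H y) => E.
  have -> : y / (2 * c) = (2 * c)^-1 * y by rewrite mulrC.
  by rewrite mulN1r mulNr -mulrA -E mulKf// mulf_neq0// gt_eqF.
pose K (t : R) := H t * expR ((4 * c)^-1 * t ^+ 2).
have dK (y : R) : is_derive y 1 K 0.
  have d1 : is_derive y 1 (fun x : R => (4 * c)^-1 * x ^+ 2) ((4 * c)^-1 * (2 * y)).
    apply: (is_derive_eq (is_deriveZ (4 * c)^-1 (is_deriveX 2 (is_derive_id y (1 : R))))).
    by rewrite /GRing.scale/= expr1 mulr1.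
  apply: (is_derive_eq (is_deriveM (dH y) (is_derive1_comp (is_derive_expR _) d1))).
  by rewrite /GRing.scale/=; field; rewrite gt_eqF.
have KE := is_derive_0_is_cst t 0 dK.
have K0 : K 0 = Num.sqrt pi / Num.sqrt c.
  rewrite /K /H expr0n/= mulr0 expR0 mulr1.
  under eq_Rintegral do rewrite mul0r cos0 mulr1.
  by rewrite /Rintegral integral_gaussian.
by rewrite -K0 -KE /K /gaussian -mulrA -expRD subrr expR0 mulr1.
Qed.

End gaussian.

Lemma gaussian_cvg1 {R : realType} (x : R) : gaussian n.+1%:R^-1 x @[n --> \oo] --> (1 : R).
Proof.
rewrite -[X in _ --> X]expR0.
have lim : - (n.+1%:R^-1 * x ^+ 2) @[n --> \oo] --> (0 : R).
  rewrite -[X in _ --> X]oppr0; apply: cvgN.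
  by rewrite -[X in _ --> X](mul0r (x ^+ 2)); apply: cvgM; [exact: cvg_harmonic|exact: cvg_cst].
exact: (cvg_comp _ _ lim (@continuous_expR R 0)).
Qed.

(** * Inversion of a nonnegative Fourier transform *)

Section inversion.
Context {R : realType}.
Notation mu := (@lebesgue_measure R).
Variable phi : R -> R.
Hypothesis cphi : continuous phi.
Hypothesis phi_ge0 : forall x, 0 <= phi x.
Hypothesis phi_le1 : forall x, phi x <= 1.
Hypothesis phiN : forall x, phi (- x) = phi x.
Hypothesis phi0 : phi 0 = 1.
Hypothesis iphi : mu.-integrable setT (EFin \o phi).
Hypothesis phi_pos : forall x : R, 0 <= \int[mu]_y (phi y * cos (x * y)).

(** The candidate density. The cosine suffices since [phi] is even. Nonnegativity comes from
    [phi_pos]; integrability has to be earned below. *)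
Definition inverse_fourier (x : R) : R := (2 * pi)^-1 * \int[mu]_y (phi y * cos (x * y)).
Let f := inverse_fourier.

Let pi0 : 0 < (pi : R). Proof. exact: pi_gt0. Qed.

Let i2pi0 : 0 < (2 * pi : R)^-1. Proof. by rewrite invr_gt0 mulr_gt0. Qed.

Lemma inverse_fourier_ge0 x : 0 <= f x.
Proof. by rewrite mulr_ge0 ?(ltW i2pi0). Qed.

Lemma inverse_fourierN x : f (- x) = f x.
Proof. by congr (_ * _); apply: eq_Rintegral => y _; rewrite mulNr cosN. Qed.

Let iphic (x : R) : mu.-integrable setT (EFin \o (fun y => phi y * cos (x * y))).
Proof.
apply: integrable_bounded_mul => //; last by move=> y; exact: cos_max.
by apply: continuous_scaled; exact: continuous_cos.
Qed.

Lemma continuous_inverse_fourier : continuous f.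
Proof.
move=> x; apply: cvgM; first exact: cvg_cst.
have I : x - 1 < x < x + 1 by lra.
apply: (@continuity_under_integral R _ _ mu (fun x y => phi y * cos (x * y)) setT
  measurableT (x - 1) (x + 1) _ _ phi iphi) => //.
- apply: aeW => y _; have hx : continuous (fun z : R => phi y * cos (z * y)).
    move=> z; apply: cvgM; first exact: cvg_cst.
    apply: (@continuous_comp _ _ _ (fun z : R => z * y) cos); last exact: continuous_cos.
    by apply: cvgM; [exact: cvg_id|exact: cvg_cst].
  by move=> z _; exact: hx.
- by move=> z _; apply: aeW => y _; rewrite normrM ger0_norm// ler_piMr ?cos_max.
- by rewrite inE/= in_itv/=.
Qed.

Lemma inverse_fourier_le x : f x <= f 0.
Proof.
rewrite ler_pM2l//; apply: le_Rintegral => // y _.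
by rewrite mul0r cos0 ler_wpM2l ?cos_le1.
Qed.

(* The Gaussian regularisation of [phi] at [t], at scale [l]. *)
Let B (l t : R) := \int[mu]_z (phi (t + l * z) * gaussian 1 z).

Let integrable_phi_gaussian (l t : R) :
  mu.-integrable setT (EFin \o (fun z => phi (t + l * z) * gaussian 1 z)).
Proof.
rewrite (_ : _ \o _ = EFin \o (fun z => gaussian 1 z * phi (t + l * z))); last first.
  by apply/funext => z /=; rewrite mulrC.
apply: (@integrable_bounded_mul R (gaussian 1) (fun z => phi (t + l * z))).
- exact: integrable_gaussian.
- move=> z; apply: (@continuous_comp _ _ _ (fun z : R => t + l * z) phi); last exact: cphi.
  by apply: cvgD; [exact: cvg_cst|apply: cvgM; [exact: cvg_cst|exact: cvg_id]].
- by move=> z; rewrite ger0_norm.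
Qed.

(** Fubini moves the transform from [phi] to the Gaussian, leaving a convolution of [phi] with a
    narrow Gaussian. It appears at both [t] and [- t] because a product of two cosines is a half sum
    of two. *)
Let regularise (c t : R) : 0 < c ->
  \int[mu]_x (f x * (gaussian c x * cos (t * x))) =
  (B (2 * Num.sqrt c) t + B (2 * Num.sqrt c) (- t)) / (2 * Num.sqrt pi).
Proof.
move=> c0.
have sc0 : 0 < Num.sqrt c by rewrite sqrtr_gt0.
have sp0 : 0 < Num.sqrt (pi : R) by rewrite sqrtr_gt0.
have E1 : \int[mu]_x (f x * (gaussian c x * cos (t * x))) =
  (2 * pi)^-1 * \int[mu]_x (gaussian c x * \int[mu]_y (phi y * (cos (t * x) * cos (x * y)))).
  have cJ : continuous (fun x => cos (t * x) * (2 * pi * f x)).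
    move=> x; apply: cvgM; first by apply: continuous_scaled; exact: continuous_cos.
    by apply: cvgM; [exact: cvg_cst|exact: continuous_inverse_fourier].
  have JE x : \int[mu]_y (phi y * (cos (t * x) * cos (x * y))) = cos (t * x) * (2 * pi * f x).
    rewrite /f /inverse_fourier mulVKf ?gt_eqF ?mulr_gt0//.
    by rewrite -RintegralZl//; apply: eq_Rintegral => y _; rewrite mulrCA.
  under [in RHS]eq_Rintegral do rewrite JE.
  rewrite -RintegralZl//; last first.
    apply: (@integrable_bounded_mulM R _ _ (2 * pi * f 0)) => //; first exact: integrable_gaussian.
    move=> x; rewrite normrM -[leRHS]mul1r ler_pM ?cos_max//.
    have pi2 : 0 <= 2 * pi :> R by rewrite mulr_ge0// ltW.
    by rewrite (ger0_norm (mulr_ge0 pi2 (inverse_fourier_ge0 x))) ler_wpM2l// inverse_fourier_le.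
  have cancel (u v w q : R) : q != 0 -> u * (v * w) = q^-1 * (v * (w * (q * u))) by move=> ?; field.
  by apply: eq_Rintegral => x _; apply: cancel; rewrite gt_eqF// mulr_gt0.
have d0 : 0 < (4 * c)^-1 by rewrite invr_gt0 mulr_gt0.
have cgs (s : R) : continuous (fun y => gaussian (4 * c)^-1 (s - y)).
  move=> y; apply: (@continuous_comp _ _ _ (fun y : R => s - y) (gaussian (4 * c)^-1)).
    by apply: cvgB; [exact: cvg_cst|exact: cvg_id].
  exact: continuous_gaussian.
have igs (s : R) : mu.-integrable setT (EFin \o (fun y => phi y * gaussian (4 * c)^-1 (s - y))).
  apply: integrable_bounded_mul => // y.
  by rewrite gtr0_norm ?gaussian_gt0 ?gaussian_le1 ?(ltW d0).
(* The substitution [y = s + 2 * Num.sqrt c * z] reduces the width to that of [gaussian 1], whence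
   the scale in [B]. *)
have shift (s : R) : \int[mu]_y (phi y * gaussian (4 * c)^-1 (s - y)) =
    2 * Num.sqrt c * B (2 * Num.sqrt c) s.
  rewrite /B -RintegralZl//; congr fine.
  rewrite (@integral_affine R _ (2 * Num.sqrt c) s) ?mulr_gt0//; first last.
  - by move=> y; rewrite mulr_ge0 ?(ltW (gaussian_gt0 _ _)).
  - move=> y; apply: cvgM; [exact: cphi|exact: cgs].
  apply: eq_integral => z _; congr (_%:E); rewrite mulrC; congr (_ * (_ * _)).
  rewrite /gaussian; congr (expR (- _)); rewrite opprD addNKr sqrrN !exprMn sqr_sqrtr ?(ltW c0)//.
  by field; rewrite gt_eqF.
have inner (y : R) : \int[mu]_x (gaussian c x * (cos (t * x) * cos (x * y))) =
    Num.sqrt pi / Num.sqrt c / 2 * (gaussian (4 * c)^-1 (t - y) + gaussian (4 * c)^-1 (- t - y)).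
  have ic (s : R) : mu.-integrable setT (EFin \o (fun x => gaussian c x * cos (s * x))).
    apply: integrable_bounded_mul; first exact: integrable_gaussian.
      by apply: continuous_scaled; exact: continuous_cos.
    by move=> x; exact: cos_max.
  have -> : gaussian (4 * c)^-1 (- t - y) = gaussian (4 * c)^-1 (t + y).
    by rewrite -opprD gaussianN.
  rewrite mulrAC mulrDr -!gaussian_FT// -RintegralD// mulrC -RintegralZl//; last first.
    exact: (integrableD measurableT (ic _) (ic _)).
  apply: eq_Rintegral => x _.
  have -> : (t - y) * x = t * x - x * y by ring.
  have -> : (t + y) * x = t * x + x * y by ring.
  by rewrite cosB cosD; field.
have mk : measurable_fun setT (fun z : R * R => cos (t * z.1) * cos (z.1 * z.2)).
  have mcos : measurable_fun setT (@cos R) by apply: continuous_measurable_fun; exact: continuous_cos.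
  by apply: measurable_funM; apply: (measurableT_comp mcos); apply: measurable_funM.
have k1 (z : R * R) : `|cos (t * z.1) * cos (z.1 * z.2)| <= 1.
  by rewrite normrM mulr_ile1 ?cos_max.
have /= swap := @Rintegral_swap R (gaussian c) phi _ (integrable_gaussian c0) iphi mk k1.
rewrite E1 swap.
under eq_Rintegral do rewrite inner mulrCA mulrDr.
rewrite RintegralZl//; last exact: (integrableD measurableT (igs _) (igs _)).
rewrite RintegralD//.
- rewrite !shift.
  have -> : (2 * pi : R)^-1 = (2 * (Num.sqrt pi * Num.sqrt pi))^-1.
    by rewrite -expr2 sqr_sqrtr// ltW.
  by field; rewrite !gt_eqF.
Qed.

Let eps_ (n : nat) : R := n.+1%:R^-1.

Let eps_gt0 n : 0 < eps_ n. Proof. by rewrite invr_gt0. Qed.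

Let eps_cvg0 : eps_ n @[n --> \oo] --> 0. Proof. exact: cvg_harmonic. Qed.

Let B_cvg t : B (2 * Num.sqrt (eps_ n)) t @[n --> \oo] --> phi t * Num.sqrt pi.
Proof.
have -> : phi t * Num.sqrt pi = \int[mu]_z (phi t * gaussian 1 z).
  rewrite RintegralZl//; last exact: integrable_gaussian.
  by rewrite /Rintegral integral_gaussian// sqrtr1 divr1.
apply: (@Rdominated_cvg R _ _ (gaussian 1)).
- move=> n; apply/measurable_EFinP.
  exact: measurable_int (integrable_phi_gaussian (2 * Num.sqrt (eps_ n)) t).
- move=> z; apply: cvgM; last exact: cvg_cst.
  suff lim : t + 2 * Num.sqrt (eps_ n) * z @[n --> \oo] --> t.
    exact: (cvg_comp _ _ lim (@cphi t)).
  have lim0 : Num.sqrt (eps_ n) @[n --> \oo] --> (0 : R).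
    rewrite -[X in _ --> X]sqrtr0.
    exact: (cvg_comp _ _ eps_cvg0 (@sqrt_continuous R 0)).
  rewrite -[X in _ --> X]addr0; apply: cvgD; first exact: cvg_cst.
  rewrite -[X in _ --> X](mul0r z); apply: cvgM; last exact: cvg_cst.
  by rewrite -[X in _ --> X](mulr0 2); apply: cvgM; [exact: cvg_cst|exact: lim0].
- exact: integrable_gaussian.
- by move=> n z; rewrite normrM (gtr0_norm (gaussian_gt0 _ _)) ger0_norm// ler_piMl// ltW// gaussian_gt0.
Qed.

Let regularised_cvg t :
  \int[mu]_x (f x * (gaussian (eps_ n) x * cos (t * x))) @[n --> \oo] --> phi t.
Proof.
under eq_fun do rewrite regularise//.
have -> : phi t = (phi t * Num.sqrt pi + phi (- t) * Num.sqrt pi) / (2 * Num.sqrt pi).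
  by rewrite phiN; field; rewrite gt_eqF// sqrtr_gt0.
by apply: cvgM; [apply: cvgD; exact: B_cvg|exact: cvg_cst].
Qed.

Let integrable_f_gaussian n : mu.-integrable setT (EFin \o (fun x => f x * gaussian (eps_ n) x)).
Proof.
rewrite (_ : (fun x => _) = (fun x => gaussian (eps_ n) x * f x)); last by apply/funext => x; rewrite mulrC.
apply: (@integrable_bounded_mulM R _ _ (f 0)).
- exact: integrable_gaussian.
- exact: continuous_inverse_fourier.
- by move=> x; rewrite ger0_norm ?inverse_fourier_ge0 ?inverse_fourier_le.
Qed.

Let mf : measurable_fun setT f.
Proof. by apply: continuous_measurable_fun; exact: continuous_inverse_fourier. Qed.

Let integral_inverse_fourier : (\int[mu]_x (f x)%:E = 1%:E)%E.
Proof.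
have mono : ((\int[mu]_x (f x * gaussian (eps_ n) x)%:E)%E @[n --> \oo] -->
    (\int[mu]_x limn (fun n => (f x * gaussian (eps_ n) x)%:E))%E).
  apply: cvg_monotone_convergence => //.
  - by move=> n; exact: measurable_int (integrable_f_gaussian n).
  - by move=> n x _; rewrite lee_fin mulr_ge0 ?inverse_fourier_ge0// ltW// gaussian_gt0.
  - move=> x _ n m nm; rewrite lee_fin ler_wpM2l ?inverse_fourier_ge0//.
    rewrite ler_expR lerN2 ler_wpM2r ?sqr_ge0// lef_pV2 ?posrE//.
    by rewrite ler_nat ltnS.
have lim1 : (\int[mu]_x (f x)%:E = \int[mu]_x limn (fun n => (f x * gaussian (eps_ n) x)%:E))%E.
  apply: eq_integral => x _; apply/esym/cvg_lim => //.
  apply: cvg_EFin; first exact: nearW.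
  by rewrite -[X in _ --> X]mulr1; apply: cvgM; [exact: cvg_cst|exact: gaussian_cvg1].
rewrite lim1; apply: (cvg_unique _ mono) => //.
apply: cvg_EFin.
  by apply: nearW => n; exact: integrable_fin_num (integrable_f_gaussian n).
rewrite -phi0; have := @regularised_cvg 0.
by under eq_fun do under eq_Rintegral do rewrite mul0r cos0 mulr1.
Qed.

Let integrable_f : mu.-integrable setT (EFin \o f).
Proof.
apply/integrableP; split; first exact/measurable_EFinP.
under eq_integral do rewrite /= ger0_norm ?inverse_fourier_ge0//.
by rewrite integral_inverse_fourier ltry.
Qed.

(** With [f] now integrable, it dominates the regularised integrands. *)
Let fourier_inverse t : \int[mu]_x (cos (t * x) * f x) = phi t.
Proof.
suff H : \int[mu]_x (f x * (gaussian (eps_ n) x * cos (t * x))) @[n --> \oo] -->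
    \int[mu]_x (cos (t * x) * f x).
  exact: (cvg_unique _ H (@regularised_cvg t)).
apply: (@Rdominated_cvg R _ _ f) => //.
- move=> n; apply: measurable_funM => //; apply: measurable_funM.
    by apply: continuous_measurable_fun; exact: continuous_gaussian.
  by apply: continuous_measurable_fun; apply: continuous_scaled; exact: continuous_cos.
- move=> x; rewrite [cos (t * x) * f x]mulrC; apply: cvgM; first exact: cvg_cst.
  by rewrite -[X in _ --> X]mul1r; apply: cvgM; [exact: gaussian_cvg1|exact: cvg_cst].
- move=> n x; rewrite normrM ger0_norm ?inverse_fourier_ge0// ler_piMr ?inverse_fourier_ge0//.
  by rewrite normrM mulr_ile1 ?cos_max// ger0_norm ?gaussian_le1// ltW// gaussian_gt0.
Qed.

Lemma charfun_of_positive_transform : is_charfun (fun xi => (phi xi)%:C%C).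
Proof.
have f1 : \int[mu]_x f x = 1 by rewrite /Rintegral integral_inverse_fourier.
have [m mE] := density_probability inverse_fourier_ge0 integrable_f f1.
have mh (h : R -> R) (xi : R) : continuous h -> measurable_fun setT (fun x : R => h (xi * x)).
  by move=> ch; apply: continuous_measurable_fun; exact: continuous_scaled.
exists m => xi; rewrite /charfun /Cintegral /=.
rewrite (mE (fun x => cos (xi * x))); [|by apply: mh; exact: continuous_cos|by move=> x; exact: cos_max].
rewrite (mE (fun x => sin (xi * x))); [|by apply: mh; exact: continuous_sin|by move=> x; exact: sin_max].
rewrite fourier_inverse Rintegral_line_odd //.
- rewrite (_ : (fun x => _) = (fun x => f x * sin (xi * x))); last by apply/funext => x; rewrite mulrC.
  apply: integrable_bounded_mul => //; last by move=> x; exact: sin_max.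
  by apply: continuous_scaled; exact: continuous_sin.
- move=> x; apply: cvgM; last exact: continuous_inverse_fourier.
  by apply: continuous_scaled; exact: continuous_sin.
- by move=> x; rewrite mulrN sinN inverse_fourierN mulNr.
Qed.

End inversion.

(** * Stable laws *)

Section positive_transforms.
Context {R : realType}.
Notation mu := (@lebesgue_measure R).
Implicit Types (h b q : R -> R).

(** For even [h], nonnegativity of the Fourier transform. It passes through dominated limits,
    nonnegative combinations and products with mixtures of cosines. *)
Definition positive_transform h := forall x : R, 0 <= \int[mu]_y (h y * cos (x * y)).

Let int_cos h (x : R) : mu.-integrable setT (EFin \o h) ->
  mu.-integrable setT (EFin \o (fun y => h y * cos (x * y))).
Proof.
move=> ih; apply: integrable_bounded_mul => //; last by move=> y; exact: cos_max.
by apply: continuous_scaled; exact: continuous_cos.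
Qed.

Lemma positive_transform_lim (h_ : nat -> R -> R) h g :
  (forall n, measurable_fun setT (h_ n)) ->
  (forall y, h_ n y @[n --> \oo] --> h y) ->
  mu.-integrable setT (EFin \o g) -> (forall n y, `|h_ n y| <= g y) ->
  (forall n, positive_transform (h_ n)) -> positive_transform h.
Proof.
move=> mh hh ig hg hpos x.
have H : \int[mu]_y (h_ n y * cos (x * y)) @[n --> \oo] --> \int[mu]_y (h y * cos (x * y)).
  apply: (@Rdominated_cvg R _ _ g) => //.
  - move=> n; apply: measurable_funM => //.
    by apply: continuous_measurable_fun; apply: continuous_scaled; exact: continuous_cos.
  - by move=> y; apply: cvgM; [exact: hh|exact: cvg_cst].
  - by move=> n y; rewrite normrM; apply: le_trans (hg n y); rewrite ler_piMr ?cos_max.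
by rewrite -(cvg_lim _ H)//; apply: limr_ge; [apply/cvg_ex; eexists; exact: H|apply: nearW => n; exact: hpos].
Qed.

Lemma positive_transformZ (c : R) h : 0 <= c -> mu.-integrable setT (EFin \o h) ->
  positive_transform h -> positive_transform (fun y => c * h y).
Proof.
move=> c0 ih hpos x; under eq_Rintegral do rewrite -mulrA.
by rewrite RintegralZl ?mulr_ge0//; exact: int_cos.
Qed.

Lemma positive_transformD h1 h2 : mu.-integrable setT (EFin \o h1) ->
  mu.-integrable setT (EFin \o h2) ->
  positive_transform h1 -> positive_transform h2 -> positive_transform (fun y => h1 y + h2 y).
Proof.
move=> i1 i2 p1 p2 x; under eq_Rintegral do rewrite mulrDl.
by rewrite RintegralD ?addr_ge0//; exact: int_cos.
Qed.

Section cosine_mixture.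
Variables (b q : R -> R).
Hypothesis b0 : forall v, 0 <= b v.
Hypothesis ib : mu.-integrable setT (EFin \o b).
Hypothesis cq : continuous q.

(** The Fourier transform of a finite symmetric measure: the measure with density [b], pushed
    forward by [q] and symmetrised. Later [q] is [expR], which parametrises the positive half
    line. *)
Definition cosine_mixture (y : R) := \int[mu]_v (b v * cos (y * q v)).
Let N := cosine_mixture.
Let M := \int[mu]_v b v.

Let ibc (y : R) : mu.-integrable setT (EFin \o (fun v => b v * cos (y * q v))).
Proof.
apply: integrable_bounded_mul => //; last by move=> v; exact: cos_max.
move=> v; apply: (@continuous_comp _ _ _ (fun v => y * q v) cos); last exact: continuous_cos.
by apply: cvgM; [exact: cvg_cst|exact: cq].
Qed.

Lemma continuous_cosine_mixture : continuous N.
Proof.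
move=> x; have I : x - 1 < x < x + 1 by lra.
apply: (@continuity_under_integral R _ _ mu (fun y v => b v * cos (y * q v)) setT
  measurableT (x - 1) (x + 1) _ _ b ib) => //.
- apply: aeW => v _; have hx : continuous (fun z : R => b v * cos (z * q v)).
    move=> z; apply: cvgM; first exact: cvg_cst.
    apply: (@continuous_comp _ _ _ (fun z : R => z * q v) cos); last exact: continuous_cos.
    by apply: cvgM; [exact: cvg_id|exact: cvg_cst].
  by move=> z _; exact: hx.
- by move=> z _; apply: aeW => v _; rewrite normrM ger0_norm// ler_piMr ?cos_max.
- by rewrite inE/= in_itv/=.
Qed.

Lemma cosine_mixture_norm y : `|N y| <= M.
Proof.
apply: (le_trans (le_normr_Rintegral measurableT (ibc y))).
apply: le_Rintegral => //; first exact: integrable_norm (ibc y).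
by move=> v _; rewrite normrM ger0_norm// ler_piMr ?cos_max.
Qed.

Lemma integrableM_cosine_mixture h : mu.-integrable setT (EFin \o h) ->
  mu.-integrable setT (EFin \o (fun y => h y * N y)).
Proof.
by move=> ih; exact: (integrable_bounded_mulM ih continuous_cosine_mixture cosine_mixture_norm).
Qed.

(** Multiplying [h] by [cos (y * q v)] averages the translates of its transform by [q v] and
    [- q v]; the mixture then integrates these against the nonnegative [b]. *)
Lemma positive_transformM_cosine_mixture h : mu.-integrable setT (EFin \o h) ->
  positive_transform h -> positive_transform (fun y => h y * N y).
Proof.
move=> ih hpos x.
have -> : \int[mu]_y (h y * N y * cos (x * y)) =
    \int[mu]_y (h y * \int[mu]_v (b v * (cos (y * q v) * cos (x * y)))).
  apply: eq_Rintegral => y _; rewrite -mulrA; congr (_ * _).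
  by rewrite -RintegralZr//; apply: eq_Rintegral => v _; rewrite mulrA.
have mk : measurable_fun setT (fun z : R * R => cos (z.1 * q z.2) * cos (x * z.1)).
  have mcos : measurable_fun setT (@cos R) by apply: continuous_measurable_fun; exact: continuous_cos.
  have mq : measurable_fun setT q by exact: continuous_measurable_fun.
  apply: measurable_funM; apply: (measurableT_comp mcos); apply: measurable_funM => //.
  exact: (measurableT_comp mq measurable_snd).
have k1 (z : R * R) : `|cos (z.1 * q z.2) * cos (x * z.1)| <= 1.
  by rewrite normrM mulr_ile1 ?cos_max.
have /= -> := @Rintegral_swap R h b _ ih ib mk k1.
apply: Rintegral_ge0 => v _; rewrite mulr_ge0//.
have -> : \int[mu]_y (h y * (cos (y * q v) * cos (x * y))) =
  2^-1 * (\int[mu]_y (h y * cos ((x + q v) * y)) + \int[mu]_y (h y * cos ((x - q v) * y))).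
  rewrite -RintegralD//; [|exact: int_cos..].
  rewrite -RintegralZl//; last exact: (integrableD measurableT (int_cos _ ih) (int_cos _ ih)).
  apply: eq_Rintegral => y _.
  have -> : (x + q v) * y = x * y + y * q v by ring.
  have -> : (x - q v) * y = x * y - y * q v by ring.
  by rewrite cosB cosD; field.
by rewrite mulr_ge0// addr_ge0.
Qed.

(** The partial sums of the exponential series have nonnegative coefficients, hence keep the
    transform nonnegative, and they are dominated by [|h| * expR M]. *)
Lemma positive_transformM_exp_mixture h : mu.-integrable setT (EFin \o h) ->
  positive_transform h -> positive_transform (fun y => h y * expR (N y)).
Proof.
move=> ih hpos.
have pX k : mu.-integrable setT (EFin \o (fun y => h y * N y ^+ k)) /\
    positive_transform (fun y => h y * N y ^+ k).
  elim: k => [|k [ik pk]].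
    by rewrite (_ : (fun y => _) = h)//; apply/funext => y; rewrite expr0 mulr1.
  rewrite (_ : (fun y => _) = (fun y => h y * N y ^+ k * N y)); last first.
    by apply/funext => y; rewrite exprSr mulrA.
  by split; [exact: integrableM_cosine_mixture|exact: positive_transformM_cosine_mixture].
have pS n : mu.-integrable setT (EFin \o (fun y => h y * series (exp_coeff (N y)) n)) /\
    positive_transform (fun y => h y * series (exp_coeff (N y)) n).
  elim: n => [|n [ik pk]].
    rewrite (_ : (fun y => _) = cst 0); last first.
      by apply/funext => y; rewrite /series/= big_geq// mulr0.
    split; first exact: integrable0.
    by move=> x; apply: Rintegral_ge0 => y _; rewrite mul0r.
  have [i1 p1] := pX n.
  have i2 : mu.-integrable setT (EFin \o (fun y => n`!%:R^-1 * (h y * N y ^+ n))).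
    exact: (integrableZl measurableT _ i1).
  rewrite (_ : (fun y => _) = (fun y => h y * series (exp_coeff (N y)) n + n`!%:R^-1 * (h y * N y ^+ n))); last first.
    by apply/funext => y; rewrite seriesSr mulrDr /exp_coeff/=; congr (_ + _); rewrite mulrA mulrC.
  split; first exact: (integrableD measurableT ik i2).
  by apply: positive_transformD => //; apply: positive_transformZ => //; rewrite invr_ge0.
apply: (@positive_transform_lim (fun n y => h y * series (exp_coeff (N y)) n) _ (fun y => `|h y| * expR M)).
- by move=> n; apply/measurable_EFinP; exact: measurable_int (pS n).1.
- move=> y; apply: cvgM; first exact: cvg_cst.
  exact: is_cvg_series_exp_coeff.
- rewrite (_ : _ \o _ = fun y => ((expR M)%:E * (`|h y|)%:E)%E); last by apply/funext => y /=; rewrite mulrC.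
  exact: (integrableZl measurableT _ (integrable_norm ih)).
- move=> n y; rewrite normrM ler_wpM2l//.
  apply: (@le_trans _ _ (expR `|N y|)); last by rewrite ler_expR cosine_mixture_norm.
  apply: (@le_trans _ _ (series (exp_coeff `|N y|) n)).
    apply: le_trans (ler_norm_sum _ _ _) _; apply: ler_sum => k _.
    by rewrite /exp_coeff/= normrM normrX [`|_^-1|]ger0_norm ?invr_ge0.
  apply: nondecreasing_cvgn_le; last exact: is_cvg_series_exp_coeff.
  by apply: nondecreasing_series => k _ _; exact: exp_coeff_ge0.
- by move=> n; exact: (pS n).2.
Qed.

End cosine_mixture.

End positive_transforms.

(** * The Levy integral for exponents below two *)

Section stable_laws.
Context {R : realType}.
Notation mu := (@lebesgue_measure R).

(** The common majorant for the Levy integrand and for the stable functions. *)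
Lemma integrable_cauchy : mu.-integrable setT (EFin \o (fun x : R => (oneDsqr x)^-1)).
Proof.
have c0 (x : R) : 0 <= (oneDsqr x)^-1 by rewrite invr_ge0 /oneDsqr addr_ge0 ?sqr_ge0.
have cc : continuous (fun x : R => (oneDsqr x)^-1) by exact: continuous_oneDsqrV.
apply/integrableP; split.
  by apply/measurable_EFinP; exact: continuous_measurable_fun.
under eq_integral do rewrite /= ger0_norm//.
rewrite ge0_symfun_integralT//; last by move=> x; rewrite /= /oneDsqr sqrrN.
rewrite (_ : [set x | _] = `[0, +oo[%classic); last first.
  by apply/seteqP; split => x/=; rewrite in_itv/= andbT.
by rewrite integral0y_oneDsqr -EFinM ltry.
Qed.

(** Both sides are compared with [(1 + c * z / 2) ^+ 2]; the coefficient [4 / c ^+ 2] turns its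
    quadratic term into [z ^+ 2]. *)
Lemma oneDsqr_le_exp (c z : R) : 0 < c -> 0 <= z ->
  oneDsqr z <= (1 + 4 / c ^+ 2) * expR (c * z).
Proof.
move=> c0 z0; have E : expR (c * z) = expR (c * z / 2) ^+ 2.
  by rewrite -expRM_natr; congr expR; field.
have cz : 0 <= c * z / 2 by rewrite divr_ge0// mulr_ge0// ltW.
have H : (1 + c * z / 2) ^+ 2 <= expR (c * z / 2) ^+ 2.
  by rewrite ler_sqr ?nnegrE ?expR_ge0 ?addr_ge0// expR_ge1Dx.
rewrite E; apply: (@le_trans _ _ ((1 + 4 / c ^+ 2) * (1 + c * z / 2) ^+ 2)); last first.
  by rewrite ler_wpM2l// addr_ge0// divr_ge0// sqr_ge0.
have -> : (1 + 4 / c ^+ 2) * (1 + c * z / 2) ^+ 2 =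
    oneDsqr z + (c * z + (c * z / 2) ^+ 2 + 4 / c ^+ 2 * (1 + c * z)).
  by rewrite /oneDsqr; field; rewrite gt_eqF.
have cz' : 0 <= c * z by rewrite mulr_ge0// ltW.
by rewrite lerDl !addr_ge0 ?sqr_ge0 ?mulr_ge0 ?invr_ge0 ?sqr_ge0 ?addr_ge0// ltW.
Qed.

Lemma one_sub_cos_le (y : R) : 0 < y -> 1 - cos y <= y ^+ 2.
Proof.
move=> y0; have y20 : 0 < y / 2 by rewrite divr_gt0.
have [|c _] := @MVT R sin cos 0 (y / 2) y20 (fun x _ => is_derive_sin x).
  by apply: continuous_subspaceT => x; exact: continuous_sin.
rewrite sin0 !subr0 => sE.
have cE : cos y = 1 - 2 * sin (y / 2) ^+ 2.
  have -> : y = y / 2 + y / 2 by field.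
  by rewrite cosD; have := cos2Dsin2 (y / 2); have -> : (y / 2 + y / 2) / 2 = y / 2 by [field]; nra.
have c21 : 0 <= 1 - cos c ^+ 2 by rewrite -(cos2Dsin2 c) addrAC subrr add0r sqr_ge0.
have := mulr_ge0 c21 (sqr_ge0 y); have := sqr_ge0 y.
rewrite cE sE exprMn exprMn; lra.
Qed.

Section exponent_below_two.
Variable alpha : R.
Hypothesis alpha_gt0 : 0 < alpha.
Hypothesis alpha_lt2 : alpha < 2.

(* After the substitution y = expR u, the Levy measure [y ^ (-1 - alpha) dy] becomes [expR (- alpha u) du] and dilations become translations. *)
Definition levy_integrand (xi u : R) := expR (- (alpha * u)) * (1 - cos (xi * expR u)).
Let w := levy_integrand.

Let w_ge0 xi u : 0 <= w xi u.
Proof. by rewrite mulr_ge0 ?expR_ge0// subr_ge0 cos_le1. Qed.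

Let cexp (c : R) : continuous (fun u : R => expR (c * u)).
Proof. by apply: continuous_scaled; exact: continuous_expR. Qed.

Let cw xi : continuous (w xi).
Proof.
move=> u; apply: cvgM.
  apply: (@continuous_comp _ _ _ (fun u : R => - (alpha * u)) expR); last exact: continuous_expR.
  by apply: cvgN; apply: cvgM; [exact: cvg_cst|exact: cvg_id].
apply: cvgB; first exact: cvg_cst.
apply: (@continuous_comp _ _ _ (fun u : R => xi * expR u) cos); last exact: continuous_cos.
by apply: cvgM; [exact: cvg_cst|exact: continuous_expR].
Qed.

Let Kbound : R := 2 * (1 + 4 / alpha ^+ 2) + (1 + 4 / (2 - alpha) ^+ 2).

(** For [u >= 0] the factor [1 - cos] is at most 2 and [expR (- (alpha * u))] decays. For [u < 0] it
    is at most [expR u ^+ 2], leaving [expR ((2 - alpha) * u)], which decays because [alpha < 2]. *)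
Let w1_le u : w 1 u <= Kbound * (oneDsqr u)^-1.
Proof.
have K1 : 0 <= 1 + 4 / alpha ^+ 2 by rewrite addr_ge0// divr_ge0// sqr_ge0.
have K2 : 0 <= 1 + 4 / (2 - alpha) ^+ 2 by rewrite addr_ge0// divr_ge0// sqr_ge0.
have D0 : 0 < oneDsqr u by rewrite /oneDsqr ltr_pwDl ?sqr_ge0.
rewrite ler_pdivlMr// /w /levy_integrand mul1r.
have [u0|u0] := leP 0 u.
  have H := oneDsqr_le_exp alpha_gt0 u0.
  apply: (@le_trans _ _ (expR (- (alpha * u)) * 2 * ((1 + 4 / alpha ^+ 2) * expR (alpha * u)))).
    rewrite ler_pM ?mulr_ge0 ?expR_ge0 ?(ltW D0)// ?subr_ge0 ?cos_le1//.
    by rewrite ler_wpM2l ?expR_ge0// lerBlDl -lerBlDr; have := cos_geN1 (expR u); lra.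
  have -> : expR (- (alpha * u)) * 2 * ((1 + 4 / alpha ^+ 2) * expR (alpha * u)) = 2 * (1 + 4 / alpha ^+ 2).
    by rewrite expRN; field; rewrite ?gt_eqF ?expR_gt0.
  by rewrite /Kbound lerDl.
have a2 : 0 < 2 - alpha by rewrite subr_gt0.
have Nu0 : 0 <= - u by rewrite oppr_ge0 ltW.
have H := oneDsqr_le_exp a2 Nu0.
have D : oneDsqr (- u) = oneDsqr u by rewrite /oneDsqr sqrrN.
rewrite D in H.
apply: (@le_trans _ _ (expR (- (alpha * u)) * expR u ^+ 2 * ((1 + 4 / (2 - alpha) ^+ 2) * expR ((2 - alpha) * - u)))).
  rewrite ler_pM ?mulr_ge0 ?expR_ge0 ?(ltW D0)// ?subr_ge0 ?cos_le1//.
  by rewrite ler_wpM2l ?expR_ge0// one_sub_cos_le ?expR_gt0.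
have -> : expR (- (alpha * u)) * expR u ^+ 2 * ((1 + 4 / (2 - alpha) ^+ 2) * expR ((2 - alpha) * - u)) =
    (1 + 4 / (2 - alpha) ^+ 2).
  rewrite mulrCA -[RHS]mulr1; congr (_ * _).
  by rewrite expr2 -!expRD -[RHS]expR0; congr expR; ring.
by rewrite /Kbound lerDr mulr_ge0.
Qed.

Let iw1 : mu.-integrable setT (EFin \o w 1).
Proof.
apply: (le_integrable _ _ _ (integrableZl measurableT Kbound integrable_cauchy)) => //.
  by apply/measurable_EFinP; apply: continuous_measurable_fun; exact: cw.
move=> u _ /=; rewrite lee_fin (ger0_norm (w_ge0 _ _)).
by apply: le_trans (w1_le u) _; rewrite ler_norm.
Qed.

Definition levy_constant := \int[mu]_u levy_integrand 1 u.
Let C := levy_constant.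

(** Otherwise the continuous nonnegative integrand would vanish everywhere, whereas at [u = ln pi]
    the cosine is [-1]. *)
Lemma levy_constant_gt0 : 0 < C.
Proof.
have C0 : 0 <= C by apply: Rintegral_ge0.
rewrite lt_neqAle C0 andbT eq_sym; apply/eqP => CE.
have w0 u : w 1 u = 0.
  apply: (@Rintegral_segment_eq0 R (w 1) (u - 1) (u + 1)) => //; last by lra.
  rewrite -CE; apply: fine_le; [|exact: integrable_fin_num iw1|].
    by apply: integrable_fin_num => //; exact: cont_integrable.
  apply: ge0_subset_integral => //; first exact: measurable_int iw1.
  by move=> x _; rewrite lee_fin.
have := w0 (ln pi); rewrite /w /levy_integrand mul1r lnK ?posrE ?pi_gt0// cospi.
by apply/eqP; rewrite gt_eqF// mulr_gt0 ?expR_gt0// opprK.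
Qed.

(** Dilation by [|xi|] is translation by [ln |xi|], and the exponential weight yields the factor of
    homogeneity. The form [1 * u] matches [integral_affine]. *)
Let w_scale xi u : xi != 0 -> w xi u = `|xi| `^ alpha * w 1 (ln `|xi| + 1 * u).
Proof.
move=> xi0; have n0 : 0 < `|xi| by rewrite normr_gt0.
have -> : `|xi| `^ alpha = expR (alpha * ln `|xi|) by rewrite /powR normr_eq0 (negbTE xi0).
rewrite /w /levy_integrand mulrA -expRD !mul1r; congr (expR _ * (1 - _)); first by ring.
rewrite expRD lnK ?posrE//; case: (ger0P xi) => // _.
by rewrite mulNr cosN.
Qed.

Let int_w xi : (\int[mu]_u (w xi u)%:E = (`|xi| `^ alpha * C)%:E)%E.
Proof.
have [->|xi0] := eqVneq xi 0.
  rewrite normr0 powR0 ?gt_eqF// mul0r (eq_integral (cst 0%E)) ?integral0//.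
  by move=> u _; rewrite /w /levy_integrand mul0r cos0 subrr mulr0.
under eq_integral do rewrite w_scale// EFinM.
have mw : measurable_fun setT (fun u : R => (w 1 (ln `|xi| + 1 * u))%:E).
  apply/measurable_EFinP; apply: continuous_measurable_fun => u.
  apply: (@continuous_comp _ _ _ (fun u : R => ln `|xi| + 1 * u) (w 1)); last exact: cw.
  by apply: cvgD; [exact: cvg_cst|apply: cvgM; [exact: cvg_cst|exact: cvg_id]].
rewrite ge0_integralZl//; last by move=> u _; rewrite lee_fin.
rewrite EFinM /C /levy_constant fineK; last exact: integrable_fin_num iw1.
congr (_ * _)%E.
have -> := @integral_affine R (w 1) 1 (ln `|xi|) ltr01 (@cw 1) (w_ge0 1).
by apply: eq_integral => u _; rewrite mulr1.
Qed.

Let iw xi : mu.-integrable setT (EFin \o w xi).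
Proof.
apply/integrableP; split.
  by apply/measurable_EFinP; apply: continuous_measurable_fun; exact: cw.
under eq_integral do rewrite /= ger0_norm//.
by rewrite int_w ltry.
Qed.

Lemma levy_integral_cvg xi :
  \int[mu]_(u in `[- n%:R, n%:R]) levy_integrand xi u @[n --> \oo] --> `|xi| `^ alpha * C.
Proof.
have -> : `|xi| `^ alpha * C = \int[mu]_u w xi u by rewrite /Rintegral int_w.
exact: Rintegral_cvg_segment.
Qed.

End exponent_below_two.

End stable_laws.

(** * Stable functions are characteristic functions *)

Section stable_charfun.
Context {R : realType}.
Notation mu := (@lebesgue_measure R).

Lemma positive_transform_gaussian (c : R) : 0 < c -> positive_transform (gaussian c).
Proof.
move=> c0 x; rewrite gaussian_FT// mulr_ge0 ?divr_ge0 ?sqrtr_ge0//.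
exact/ltW/gaussian_gt0.
Qed.

Definition stable_fun (alpha a xi : R) := expR (- (a * `|xi| `^ alpha)).

Lemma continuous_stable_fun (alpha a : R) : 0 < alpha -> continuous (stable_fun alpha a).
Proof.
move=> al0 x; apply: (@continuous_comp _ _ _ (fun x : R => - (a * `|x| `^ alpha)) expR); last exact: continuous_expR.
by apply: cvgN; apply: cvgM; [exact: cvg_cst|exact: continuous_normr_powR].
Qed.

Lemma stable_fun_le1 (alpha a x : R) : 0 <= a -> stable_fun alpha a x <= 1.
Proof. by move=> a0; rewrite -expR0 ler_expR oppr_le0 mulr_ge0 ?powR_ge0. Qed.

(** With [u = ln |x|], the bound [expR (alpha * u) >= (alpha * u / 2) ^+ 2] and a completed square
    give [a * |x| ^ alpha >= 2 * u - 4 / (a * alpha ^+ 2)], that is, decay like [x ^- 2]. *)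
Lemma integrable_stable_fun (alpha a : R) : 0 < alpha -> 0 < a ->
  mu.-integrable setT (EFin \o stable_fun alpha a).
Proof.
move=> al0 a0.
pose K : R := 2 * expR (4 / (a * alpha ^+ 2)).
apply: (le_integrable _ _ _ (integrableZl measurableT K integrable_cauchy)) => //.
  by apply/measurable_EFinP; apply: continuous_measurable_fun; exact: continuous_stable_fun.
move=> x _ /=; rewrite lee_fin gtr0_norm ?expR_gt0//.
apply: le_trans (ler_norm _).
have D0 : 0 < oneDsqr x by rewrite /oneDsqr ltr_pwDl ?sqr_ge0.
have e1 : 1 <= expR (4 / (a * alpha ^+ 2)).
  by rewrite -expR0 ler_expR divr_ge0// mulr_ge0 ?sqr_ge0// ltW.
rewrite ler_pdivlMr//.
have [x1|x1] := leP `|x| 1.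
  apply: (@le_trans _ _ (1 * 2)); last by rewrite /K mul1r ler_peMr.
  rewrite ler_pM ?expR_ge0 ?(ltW D0)// ?stable_fun_le1 ?(ltW a0)//.
  rewrite /oneDsqr -(real_normK (num_real x)); have := normr_ge0 x; nra.
have x0 : 0 < `|x| by lra.
pose u := ln `|x|.
have u0 : 0 < u by rewrite ln_gt0.
have xu : `|x| = expR u by rewrite lnK.
have pw : (alpha * u / 2) ^+ 2 <= `|x| `^ alpha.
  rewrite /powR gt_eqF// -/u (_ : expR _ = expR (alpha * u / 2) ^+ 2); last first.
    by rewrite -expRM_natr; congr expR; field.
  have au : 0 <= alpha * u / 2 by rewrite divr_ge0// mulr_ge0// ltW.
  rewrite ler_sqr ?nnegrE ?expR_ge0//; apply: le_trans (expR_ge1Dx _); lra.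
have amgm : 2 * u - 4 / (a * alpha ^+ 2) <= a * `|x| `^ alpha.
  apply: (@le_trans _ _ (a * (alpha * u / 2) ^+ 2)); last by rewrite ler_pM2l.
  rewrite -subr_ge0 (_ : _ - _ = a * (alpha * u / 2 - 2 / (a * alpha)) ^+ 2).
    by rewrite mulr_ge0 ?sqr_ge0// ltW.
  by field; rewrite !gt_eqF.
apply: (@le_trans _ _ (expR (4 / (a * alpha ^+ 2)) * expR (- (2 * u)) * (2 * x ^+ 2))).
  rewrite ler_pM ?expR_ge0 ?(ltW D0)//.
    by rewrite -expRD ler_expR; lra.
  rewrite /oneDsqr -(real_normK (num_real x)); have := normr_ge0 x; nra.
rewrite -(real_normK (num_real x)) xu le_eqVlt; apply/orP; left; apply/eqP.
have -> : expR u ^+ 2 = expR (2 * u) by rewrite expr2 -expRD; congr expR; ring.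
by rewrite /K expRN; field; rewrite gt_eqF ?expR_gt0.
Qed.

Section exponent_below_two.
Variable alpha : R.
Hypothesis alpha_gt0 : 0 < alpha.
Hypothesis alpha_lt2 : alpha < 2.

Let C := levy_constant alpha.

Section truncation.
Variables (a : R) (n : nat).
Hypothesis a0 : 0 <= a.

Let e (u : R) := a * expR (- (alpha * u)).
Let D : set R := `[- n%:R, n%:R]%classic.
Let b := e \_ D.

Let ce : continuous e.
Proof.
move=> u; apply: cvgM; first exact: cvg_cst.
apply: (@continuous_comp _ _ _ (fun u : R => - (alpha * u)) expR); last exact: continuous_expR.
by apply: cvgN; apply: cvgM; [exact: cvg_cst|exact: cvg_id].
Qed.

Let e0 u : 0 <= e u. Proof. by rewrite mulr_ge0 ?expR_ge0. Qed.

Let b0 u : 0 <= b u. Proof. by rewrite /b patchE; case: ifPn. Qed.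

Let ib : mu.-integrable setT (EFin \o b).
Proof.
rewrite /b -restrict_EFin; apply: (@integrable_mkcond _ _ _ mu D (EFin \o e) _).1.
  exact: measurable_itv.
exact: cont_integrable.
Qed.

Let ibc (xi : R) : mu.-integrable setT (EFin \o (fun v => b v * cos (xi * expR v))).
Proof.
apply: integrable_bounded_mul => //; last by move=> v; exact: cos_max.
move=> v; apply: (@continuous_comp _ _ _ (fun v : R => xi * expR v) cos); last exact: continuous_cos.
by apply: cvgM; [exact: cvg_cst|exact: continuous_expR].
Qed.

(** On a bounded window the Levy measure has finite mass, so [1 - cos] can be integrated term by
    term: mass minus mixture. *)
Let truncated_exponent xi :
  a * \int[mu]_(u in `[- n%:R, n%:R]) levy_integrand alpha xi u =
  \int[mu]_u b u - cosine_mixture b expR xi.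
Proof.
have cw : continuous (levy_integrand alpha xi).
  move=> u; apply: cvgM.
    apply: (@continuous_comp _ _ _ (fun u : R => - (alpha * u)) expR); last exact: continuous_expR.
    by apply: cvgN; apply: cvgM; [exact: cvg_cst|exact: cvg_id].
  apply: cvgB; first exact: cvg_cst.
  apply: (@continuous_comp _ _ _ (fun u : R => xi * expR u) cos); last exact: continuous_cos.
  by apply: cvgM; [exact: cvg_cst|exact: continuous_expR].
rewrite -RintegralZl//; last exact: cont_integrable.
rewrite Rintegral_mkcond /cosine_mixture -RintegralB//.
apply: eq_Rintegral => u _; rewrite /b !patchE; case: ifPn => _; last by rewrite mul0r subr0.
by rewrite /e /levy_integrand; ring.
Qed.

Lemma measurable_truncated_exponent :
  measurable_fun setT (fun xi : R => a * \int[mu]_(u in `[- n%:R, n%:R]) levy_integrand alpha xi u).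
Proof.
apply: continuous_measurable_fun.
rewrite (_ : (fun xi => _) = (fun xi => \int[mu]_u b u - cosine_mixture b expR xi)); last first.
  by apply/funext => xi; exact: truncated_exponent.
move=> xi; apply: cvgB; first exact: cvg_cst.
exact: (continuous_cosine_mixture b0 ib (@continuous_expR R)).
Qed.

(** The exponential of minus the mass is a positive constant, and the Gaussian provides the
    integrability that the exponential of a mixture lacks. *)
Lemma truncated_positive_transform (eps : R) : 0 < eps ->
  positive_transform (fun xi => gaussian eps xi *
    expR (- (a * \int[mu]_(u in `[- n%:R, n%:R]) levy_integrand alpha xi u))).
Proof.
move=> eps0.
have ig := integrable_gaussian eps0.
have cN := continuous_cosine_mixture b0 ib (@continuous_expR R).
rewrite (_ : (fun xi => _) = (fun xi => expR (- \int[mu]_u b u) * (gaussian eps xi * expR (cosine_mixture b expR xi)))).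
  apply: positive_transformZ; first exact: expR_ge0.
    apply: (@integrable_bounded_mulM R _ (fun xi => expR (cosine_mixture b expR xi)) (expR (\int[mu]_u b u)) ig).
      by move=> xi; exact: (cvg_comp _ _ (cN xi) (@continuous_expR R _)).
    move=> xi; rewrite ger0_norm ?expR_ge0// ler_expR.
    apply: le_trans (ler_norm _) _.
    exact: (cosine_mixture_norm b0 ib (@continuous_expR R)).
  have P := positive_transformM_exp_mixture b0 ib (@continuous_expR R) ig (positive_transform_gaussian eps0).
  exact: P.
apply/funext => xi; rewrite truncated_exponent opprB addrC expRD.
by ring.
Qed.

End truncation.

(** The truncation is removed first, under the domination of the Gaussian. The Gaussian goes next,
    in [positive_transform_stable], where the stable function itself dominates. *)
Let regularised_positive (a eps : R) : 0 <= a -> 0 < eps ->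
  positive_transform (fun xi => gaussian eps xi * stable_fun alpha (a * C) xi).
Proof.
move=> a0 eps0.
apply: (@positive_transform_lim R (fun n xi => gaussian eps xi *
    expR (- (a * \int[mu]_(u in `[- n%:R, n%:R]) levy_integrand alpha xi u))) _ (gaussian eps)).
- move=> n; apply: measurable_funM.
    by apply: continuous_measurable_fun; exact: continuous_gaussian.
  apply: measurableT_comp; first by apply: continuous_measurable_fun; exact: continuous_expR.
  by apply: measurableT_comp => //; exact: measurable_truncated_exponent.
- move=> xi; apply: cvgM; first exact: cvg_cst.
  have lim : - (a * \int[mu]_(u in `[- n%:R, n%:R]) levy_integrand alpha xi u) @[n --> \oo] -->
      - (a * C * `|xi| `^ alpha).
    rewrite -mulrA [C * _]mulrC; apply: cvgN; apply: cvgM; first exact: cvg_cst.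
    exact: levy_integral_cvg.
  exact: (cvg_comp _ _ lim (@continuous_expR R _)).
- exact: integrable_gaussian.
- move=> n y; rewrite normrM !ger0_norm ?expR_ge0// ?(ltW (gaussian_gt0 _ _))//.
  rewrite ler_piMr ?(ltW (gaussian_gt0 _ _))// -expR0 ler_expR oppr_le0 mulr_ge0//.
  apply: Rintegral_ge0 => u _.
  by rewrite /levy_integrand mulr_ge0 ?expR_ge0// subr_ge0 cos_le1.
- by move=> n; exact: truncated_positive_transform.
Qed.

Lemma positive_transform_stable (a : R) : 0 < a -> positive_transform (stable_fun alpha a).
Proof.
move=> a0; have C0 : 0 < C by exact: levy_constant_gt0.
apply: (@positive_transform_lim R (fun n xi => gaussian n.+1%:R^-1 xi * stable_fun alpha (a / C * C) xi)
  _ (stable_fun alpha a)).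
- move=> n; apply: continuous_measurable_fun => x; apply: cvgM; first exact: continuous_gaussian.
  exact: continuous_stable_fun.
- move=> xi; rewrite divfK ?gt_eqF// -[X in _ --> X]mul1r; apply: cvgM; last exact: cvg_cst.
  exact: gaussian_cvg1.
- exact: integrable_stable_fun.
- move=> n y; rewrite divfK ?gt_eqF// ger0_norm; last by rewrite mulr_ge0 ?expR_ge0.
  by rewrite ler_piMl ?expR_ge0// gaussian_le1.
- move=> n; apply: regularised_positive; first by rewrite divr_ge0// ltW.
  by rewrite invr_gt0.
Qed.

End exponent_below_two.

(** Two cases escape the construction: for [a = 0] the law is the Dirac mass at 0, without density,
    and for [alpha = 2] the function is itself a Gaussian. *)
Lemma stable_charfun (alpha a : R) : 0 < alpha -> alpha <= 2 -> 0 <= a ->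
  is_charfun (stable_cf alpha a).
Proof.
move=> al0 al2; rewrite le_eqVlt => /orP[/eqP <-|a0].
  exists (@dirac _ (measurableTypeR R) 0 R) => xi.
  rewrite /stable_cf mul0r oppr0 expR0 /charfun /Cintegral /expi /Rintegral/=.
  have mc : measurable_fun setT (fun x : measurableTypeR R => (cos (xi * x))%:E).
    apply/measurable_EFinP; apply: continuous_measurable_fun.
    by apply: continuous_scaled; exact: continuous_cos.
  have ms : measurable_fun setT (fun x : measurableTypeR R => (sin (xi * x))%:E).
    apply/measurable_EFinP; apply: continuous_measurable_fun.
    by apply: continuous_scaled; exact: continuous_sin.
  have -> := @integral_dirac _ (measurableTypeR R) 0 R _ measurableT _ mc.
  have -> := @integral_dirac _ (measurableTypeR R) 0 R _ measurableT _ ms.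
  by rewrite diracT !mul1e mulr0 cos0 sin0.
apply: (@charfun_of_positive_transform R (stable_fun alpha a)).
- exact: continuous_stable_fun.
- by move=> x; exact: expR_ge0.
- by move=> x; apply: stable_fun_le1; exact: ltW.
- by move=> x; rewrite /stable_fun normrN.
- by rewrite /stable_fun normr0 powR0 ?gt_eqF// mulr0 oppr0 expR0.
- exact: integrable_stable_fun.
- move: al2; rewrite le_eqVlt => /orP[/eqP ->|al2]; last exact: positive_transform_stable.
  rewrite (_ : stable_fun 2 a = gaussian a); first exact: positive_transform_gaussian.
  by apply/funext => x; rewrite /stable_fun /gaussian powR_mulrn// real_normK ?num_real.
Qed.

End stable_charfun.

(** * Stationary solutions *)

Section stationary.
Context {R : realType}.
Notation mu := (@lebesgue_measure R).

(** The derivative is only known at positive times, which makes [f] constant there; right-continuity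
    carries the value to time 0. *)
Lemma derive0_right_continuous_cst (f : R -> R) :
  (forall t : R, 0 < t -> is_derive t 1 f 0) -> f s @[s --> 0^'+] --> f 0 ->
  forall t : R, 0 <= t -> f t = f 0.
Proof.
move=> df f0 t; rewrite le_eqVlt => /orP[/eqP <-//|t0].
have fE s : 0 < s -> s <= t -> f s = f t.
  move=> s0 st; apply/eqP; rewrite eq_sym -subr_eq0.
  have [||c _ ->] := @MVT_segment R f (fun=> 0) s t st; last by rewrite mul0r.
    by move=> x /[!in_itv]/= /andP[sx _]; apply: df; exact: lt_trans sx.
  apply: derivable_within_continuous => x /[!in_itv]/= /andP[sx _].
  by have [] := df x (lt_le_trans s0 sx).
have ft : f s @[s --> 0^'+] --> f t.
  apply: cvg_near_cst; near=> s; apply: fE => //; near: s.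
  exact: nbhs_right_le.
exact: (cvg_unique _ ft f0).
Unshelve. all: by end_near. Qed.

Lemma near_cst_is_derive (f : R -> R) (t c : R) :
  0 < t -> (forall s, 0 <= s -> f s = c) -> is_derive t 1 f 0.
Proof.
move=> t0 fE; have dc : is_derive t 1 (cst c : R -> R) 0 by exact: is_derive_cst.
apply: near_eq_is_derive dc.
near=> s; rewrite fE//; apply: ltW; near: s.
exact: lt_nbhsr.
Unshelve. all: by end_near. Qed.

Lemma normr_c_powR (p theta : R) : 0 <= p ->
  `|c_ p theta| `^ (2 / (1 + p)) = cos theta ^+ 2.
Proof.
move=> p0; rewrite /c_ normr_mul_powR// -powRrM mulrC divfK ?powR_mulrn//.
  by rewrite real_normK ?num_real.
by rewrite gt_eqF// ltr_wpDr.
Qed.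

Lemma normr_s_powR (p theta : R) : 0 <= p ->
  `|s_ p theta| `^ (2 / (1 + p)) = sin theta ^+ 2.
Proof.
move=> p0; rewrite /s_ normr_mul_powR// -powRrM mulrC divfK ?powR_mulrn//.
  by rewrite real_normK ?num_real.
by rewrite gt_eqF// ltr_wpDr.
Qed.

Lemma kac_rhs_stable (p a xi : R) : 0 <= p ->
  kac_rhs p (stable_cf (2 / (1 + p)) a) xi = 0.
Proof.
move=> p0; rewrite /kac_rhs /Cintegral.
pose e := expR (- (a * `|xi| `^ (2 / (1 + p)))).
have E (t : R) : (stable_cf (2 / (1 + p)) a (xi * c_ p t) *
    stable_cf (2 / (1 + p)) a (xi * s_ p t))%R = (e%:C)%C.
  rewrite /stable_cf -rmorphM -expRD -opprD -mulrDr !(normrM xi) !powRM//.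
  by rewrite normr_c_powR// normr_s_powR// -mulrDr cos2Dsin2 mulr1.
under eq_Rintegral do rewrite E/=.
under [X in (_ +i* X)%C]eq_Rintegral do rewrite E/=.
have pi20 : 0 < 2 * pi :> R by rewrite mulr_gt0// pi_gt0.
rewrite !Rintegral_cst//= lebesgue_measure_itv/= lte_fin pi20 mul0r.
rewrite -EFinB/= subr0 complexr0 -rmorphM mulrCA mulVf ?gt_eqF// mulr1.
by rewrite subrr.
Qed.

Lemma stationary_kac_rhs (p : R) (phi0 : R -> R[i]) (phi : R -> R -> R[i]) xi t :
  stationary_solution p phi0 phi -> 0 < t -> kac_rhs p (phi^~ t) xi = 0.
Proof.
move=> [[_ _ _ sol] st] t0.
have [[_ re] [_ im]] := sol xi t t0; have [[_ re0] [_ im0]] := st xi t t0.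
by apply/eqP; rewrite eq_complex -re -im re0 im0 !eqxx.
Qed.

Lemma stationary_cst (p : R) (phi0 : R -> R[i]) (phi : R -> R -> R[i]) xi t :
  stationary_solution p phi0 phi -> 0 <= t -> phi xi t = phi xi 0.
Proof.
move=> [[_ _ rc _] st] t0; have [re im] := rc xi.
apply/eqP; rewrite eq_complex; apply/andP; split; apply/eqP.
  by apply: (derive0_right_continuous_cst _ re) => // s s0; have [] := st xi s s0.
by apply: (derive0_right_continuous_cst _ im) => // s s0; have [] := st xi s s0.
Qed.

End stationary.

Theorem corollary1 (R : realType) (alpha p : R) (alpha_gt0 : 0 < alpha)
    (alpha_le2 : alpha <= 2) (pE : p = 2 / alpha - 1)
    (phi : R -> R -> R[i]) :
  (exists phi0 : R -> R[i], is_charfun phi0 /\ stationary_solution p phi0 phi) <->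
  (exists a0 : R, 0 <= a0 /\
     forall xi t : R, 0 <= t -> phi xi t = stable_cf alpha a0 xi).
Proof.
have p0 : 0 <= p by rewrite pE subr_ge0 ler_pdivlMr// mul1r.
have alphaE : 2 / (1 + p) = alpha by rewrite pE addrC subrK invf_div mulrCA divff ?mulr1.
split=> [[phi0 [_ st]]|[a [a0 phiE]]].
  have [[cf _ _ _] _] := st.
  (* The equation holds for [t > 0] only, so the law is read off at a positive time, here 1, and
     then transported to all times by constancy. *)
  have [m mE] := cf 1 ler01.
  have mE' : phi^~ 1 = charfun m by apply/funext.
  have [k k0 kE] : exists2 k, 0 <= k & forall xi,
      charfun m xi = (expR (- (k * `|xi| `^ (2 / (1 + p)))))%:C%C.
    apply: stationary_charfunE => // xi; rewrite -mE'.
    exact: stationary_kac_rhs st ltr01.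
  exists k; split=> // xi t t0.
  rewrite (stationary_cst xi st t0) -(stationary_cst xi st ler01) mE kE alphaE.
  by [].
have phiE' t : 0 <= t -> phi^~ t = stable_cf alpha a by move=> t0; apply/funext => xi; exact: phiE.
have cf := stable_charfun alpha_gt0 alpha_le2 a0.
have d0 xi t : 0 < t -> Cis_derive1 (phi xi) t 0.
  by move=> t0; split; apply: (near_cst_is_derive t0) => s s0; rewrite phiE.
exists (stable_cf alpha a); split=> //; split=> //; split.
- by move=> t t0; rewrite phiE'.
- by move=> xi; rewrite phiE.
- move=> xi; split; apply: cvg_near_cst; near=> s; rewrite !phiE//; apply: ltW; near: s;
    exact: nbhs_right_gt.
- move=> xi t t0; rewrite phiE' ?(ltW t0)// -alphaE kac_rhs_stable//.
  exact: d0.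
Unshelve. all: by end_near. Qed.
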